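(* Let $\Omega_4=\{\tfrac12,3,\tfrac13,2\}$ and $\Omega_5=\{\tfrac12,3,\tfrac13,2,1\}$. None of the four dynamical systems $(I_{F_{\Omega_4}},\sigma_{F_{\Omega_4}})$, $(I^+_{F_{\Omega_4}},\sigma^+_{F_{\Omega_4}})$, $(I_{F_{\Omega_5}},\sigma_{F_{\Omega_5}})$, $(I^+_{F_{\Omega_5}},\sigma^+_{F_{\Omega_5}})$ has the shadowing property, and the following hold. (1) $\sigma_{F_{\Omega_4}}$ is a homeomorphism on the Lelek fan $I_{F_{\Omega_4}}$ such that $(I_{F_{\Omega_4}},\sigma_{F_{\Omega_4}})$ is Devaney chaotic. (2) $\sigma^+_{F_{\Omega_4}}$ is a non-injective continuous function on the Lelek fan $I^+_{F_{\Omega_4}}$ such that $(I^+_{F_{\Omega_4}},\sigma^+_{F_{\Omega_4}})$ is Devaney chaotic. (3) $\sigma_{F_{\Omega_5}}$ is a homeomorphism on the Lelek fan $I_{F_{\Omega_5}}$ such that $(I_{F_{\Omega_5}},\sigma_{F_{\Omega_5}})$ is Devaney chaotic and topologically mixing, and has the specification property. (4) $\sigma^+_{F_{\Omega_5}}$ is a non-injective continuous function on the Lelek fan $I^+_{F_{\Omega_5}}$ such that $(I^+_{F_{\Omega_5}},\sigma^+_{F_{\Omega_5}})$ is Devaney chaotic and topologically mixing, and has the specification property.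
   Context: $I=[0,1]$. For a finite set $\Omega$ of positive reals, $F_\Omega=\{(x,y)\in I^2: y=\omega x\text{ for some }\omega\in\Omega\}$. For a closed relation $F\subseteq I\times I$: $I_F^+=\{(x_1,x_2,\ldots)\in I^{\mathbb N}: (x_i,x_{i+1})\in F\ \forall i\ge 1\}$ with shift $\sigma_F^+(x_1,x_2,\ldots)=(x_2,x_3,\ldots)$; $I_F=\{(x_i)_{i\in\mathbb Z}\in I^{\mathbb Z}: (x_i,x_{i+1})\in F\ \forall i\in\mathbb Z\}$ with shift $(\sigma_F(\mathbf x))_i=x_{i+1}$. The metrics are $\sup_{i\ge 1}|x_i-y_i|/2^{i}$ on $I_F^+$ and $\sup_{i\in\mathbb Z}|x_i-y_i|/2^{|i|}$ on $I_F$. A fan is an arcwise connected, hereditarily unicoherent continuum (nonempty compact connected metric space) with exactly one ramification point (its top $v$). It is smooth if whenever $x_n\to x$, the unique arcs from $v$ to $x_n$ converge in the Hausdorff metric to the unique arc from $v$ to $x$. An endpoint is a point that is an endpoint of every arc containing it. A Lelek fan is a smooth fan whose set of endpoints is dense (unique up to homeomorphism). Let $(Y,f)$ be a dynamical system ($Y$ compact metric with metric $d$, $f:Y\to Y$ continuous). - Transitive: for all nonempty open $U,V$ there is $n\ge 0$ with $f^n(U)\cap V\neq\emptyset$. Topologically mixing: for all nonempty open $U,V$ there is $n_0$ with $f^n(U)\cap V\ne\emptyset$ for all $n\ge n_0$. - Devaney chaotic: transitive, with a dense set of periodic points, and with sensitive dependence on initial conditions (there is $c>0$ such that for every $x\in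 Y$ and every neighbourhood $U$ of $x$ there are $y\in U$, $n\ge0$ with $d(f^n(x),f^n(y))>c$). - Shadowing property: for each $\varepsilon>0$ there is $\delta>0$ such that for each sequence $(x_k)_{k\ge0}$ in $Y$ with $d(f(x_k),x_{k+1})<\delta$ for all $k\ge 0$, there is $y\in Y$ with $d(f^k(y),x_k)<\varepsilon$ for all $k\ge0$. - Specification property: for each $\varepsilon>0$ there is a positive integer $N$ such that for all $n\ge1$, points $x_1,\ldots,x_n\in Y$ and non-negative integers $k_j\le\ell_j$ ($1\le j\le n$) with $k_{j+1}-\ell_j\ge N$ for $1\le j\le n-1$, there is $y\in Y$ with $d(f^j(y),f^j(x_i))\le\varepsilon$ for all $1\le i\le n$ and $k_i\le j\le\ell_i$. *)

(* Defs.v *)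
(* Mathematical Components / MathComp-Analysis *)
From HB Require Import structures.
From mathcomp Require Import all_boot all_order all_algebra.
From mathcomp Require Import all_classical all_reals all_analysis.

Set Implicit Arguments.
Unset Strict Implicit.
Unset Printing Implicit Defensive.

Import Order.TTheory GRing.Theory Num.Theory.
Import numFieldNormedType.Exports.

Local Open Scope classical_set_scope.
Local Open Scope ring_scope.

Definition unit_itv (R : realType) : set R := `[0, 1]%classic.

Section WeightedSup.
Context {R : realType} {J : Type} (j0 : J) (w : J -> nat).

Definition wsup_dist (x y : J -> R) : R :=
  sup (range (fun j => `|x j - y j| / 2 ^+ w j)).

Let cube (x : J -> R) := forall j, unit_itv (x j).

Lemma wsup_bound x y : cube x -> cube y ->
  forall j, `|x j - y j| / 2 ^+ w j <= 1.
Proof.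
move=> cx cy j; have := cx j; have := cy j.
rewrite /unit_itv /= !in_itv /= => /andP[y0 y1] /andP[x0 x1].
have w0 : (0 : R) < 2 ^+ w j by rewrite exprn_gt0.
have w1 : (1 : R) <= 2 ^+ w j by rewrite exprn_ege1 // ler1n.
rewrite ler_pdivrMr // mul1r (le_trans _ w1) //.
rewrite ler_norml lerBrDr lerBlDr (le_trans _ x0) /=; last first.
  by rewrite addrC subr_le0.
by rewrite (le_trans x1) // lerDl.
Qed.

Lemma wsup_has_sup x y : cube x -> cube y ->
  has_sup (range (fun j => `|x j - y j| / 2 ^+ w j)).
Proof.
move=> cx cy; split; first by exists (`|x j0 - y j0| / 2 ^+ w j0), j0.
by exists 1 => _ [j _ <-]; exact: wsup_bound.
Qed.

Lemma wsup_ub x y : cube x -> cube y ->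
  forall j, `|x j - y j| / 2 ^+ w j <= wsup_dist x y.
Proof.
move=> cx cy j; apply: sup_upper_bound; first exact: wsup_has_sup.
by exists j.
Qed.

Lemma wsup_lub x y c : cube x -> cube y ->
  (forall j, `|x j - y j| / 2 ^+ w j <= c) -> wsup_dist x y <= c.
Proof.
move=> cx cy H; have [ne _] := wsup_has_sup cx cy.
by apply: (ge_sup ne) => _ [j _ <-].
Qed.

Lemma wsup_distxx x : cube x -> wsup_dist x x = 0.
Proof.
move=> cx; apply/eqP; rewrite eq_le; apply/andP; split.
  by apply: wsup_lub => // j; rewrite subrr normr0 mul0r.
by have := wsup_ub cx cx j0; rewrite subrr normr0 mul0r.
Qed.

Lemma wsup_dist_eq0 x y : cube x -> cube y -> wsup_dist x y = 0 -> x = y.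
Proof.
move=> cx cy d0; apply/funext => j; have := wsup_ub cx cy j; rewrite d0.
rewrite ler_pdivrMr ?exprn_gt0 // mul0r normr_le0 subr_eq0.
by move/eqP.
Qed.

Lemma wsup_dist_sym x y : wsup_dist x y = wsup_dist y x.
Proof.
rewrite /wsup_dist; suff -> : (fun j => `|x j - y j| / 2 ^+ w j) =
  (fun j => `|y j - x j| / 2 ^+ w j) by [].
by apply: funext => j; rewrite distrC.
Qed.

Lemma wsup_dist_triangle y x z : cube x -> cube y -> cube z ->
  wsup_dist x z <= wsup_dist x y + wsup_dist y z.
Proof.
move=> cx cy cz; apply: wsup_lub => // j.
apply: le_trans (lerD (wsup_ub cx cy j) (wsup_ub cy cz j)).
by rewrite -mulrDl ler_pM2r ?invr_gt0 ?exprn_gt0 // ler_distD.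
Qed.

End WeightedSup.

(* [I_F^+]: the i-th coordinate of the paper is [x i.-1] here, so that the
   weight [2^i] becomes [2 ^+ i.+1]. *)
Record mahavier_plus (R : realType) (F : set (R * R)) := MahavierPlus {
  mplus_seq :> nat -> R;
  mplus_itv : forall i, unit_itv (mplus_seq i);
  mplus_rel : forall i, F (mplus_seq i, mplus_seq i.+1) }.

Record mahavier (R : realType) (F : set (R * R)) := Mahavier {
  mah_seq :> int -> R;
  mah_itv : forall i, unit_itv (mah_seq i);
  mah_rel : forall i, F (mah_seq i, mah_seq (i + 1)) }.

Lemma mplus_inj (R : realType) (F : set (R * R)) (x y : mahavier_plus F) :
  mplus_seq x = mplus_seq y -> x = y.
Proof.
case: x y => [x xi xr] [y yi yr] /= xy; subst y.
by congr MahavierPlus; exact: Prop_irrelevance.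
Qed.

Lemma mah_inj (R : realType) (F : set (R * R)) (x y : mahavier F) :
  mah_seq x = mah_seq y -> x = y.
Proof.
case: x y => [x xi xr] [y yi yr] /= xy; subst y.
by congr Mahavier; exact: Prop_irrelevance.
Qed.

Section MahavierMetric.
Context {R : realType} {F : set (R * R)}.

Definition mplus_dist (x y : mahavier_plus F) : R := wsup_dist S x y.

Definition mah_dist (x y : mahavier F) : R :=
  wsup_dist (fun i : int => `|i|%N) x y.

HB.instance Definition _ := gen_eqMixin (mahavier_plus F).
HB.instance Definition _ := gen_choiceMixin (mahavier_plus F).
HB.instance Definition _ := gen_eqMixin (mahavier F).
HB.instance Definition _ := gen_choiceMixin (mahavier F).

Fact mplus_distxx x : mplus_dist x x = 0.
Proof. exact: (wsup_distxx 0%N _ (mplus_itv x)). Qed.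

Fact mplus_dist_eq0 x y : mplus_dist x y = 0 -> x = y.
Proof.
by move=> d0; apply: mplus_inj;
  exact: (wsup_dist_eq0 0%N (mplus_itv x) (mplus_itv y) d0).
Qed.

Fact mplus_dist_sym x y : mplus_dist x y = mplus_dist y x.
Proof. exact: wsup_dist_sym. Qed.

Fact mplus_dist_triangle y x z :
  mplus_dist x z <= mplus_dist x y + mplus_dist y z.
Proof.
exact: (wsup_dist_triangle 0%N _ (mplus_itv x) (mplus_itv y) (mplus_itv z)).
Qed.

HB.instance Definition _ := @isMetric.Build R (mahavier_plus F)
  mplus_dist mplus_distxx mplus_dist_eq0 mplus_dist_sym mplus_dist_triangle.

Fact mah_distxx x : mah_dist x x = 0.
Proof. exact: (wsup_distxx (0 : int) _ (mah_itv x)). Qed.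

Fact mah_dist_eq0 x y : mah_dist x y = 0 -> x = y.
Proof.
by move=> d0; apply: mah_inj;
  exact: (wsup_dist_eq0 (0 : int) (mah_itv x) (mah_itv y) d0).
Qed.

Fact mah_dist_sym x y : mah_dist x y = mah_dist y x.
Proof. exact: wsup_dist_sym. Qed.

Fact mah_dist_triangle y x z : mah_dist x z <= mah_dist x y + mah_dist y z.
Proof.
exact: (wsup_dist_triangle (0 : int) _ (mah_itv x) (mah_itv y) (mah_itv z)).
Qed.

HB.instance Definition _ := @isMetric.Build R (mahavier F)
  mah_dist mah_distxx mah_dist_eq0 mah_dist_sym mah_dist_triangle.

End MahavierMetric.

Section Shifts.
Context {R : realType} (F : set (R * R)).

Definition mplus_shift (x : mahavier_plus F) : mahavier_plus F :=
  @MahavierPlus R F (fun i => x i.+1)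
    (fun i => mplus_itv x i.+1) (fun i => mplus_rel x i.+1).

Definition mah_shift (x : mahavier F) : mahavier F :=
  @Mahavier R F (fun i => x (i + 1))
    (fun i => mah_itv x (i + 1)) (fun i => mah_rel x (i + 1)).

End Shifts.
Arguments mplus_shift {R} F x.
Arguments mah_shift {R} F x.

Definition lines_rel (R : realType) (Omega : set R) : set (R * R) :=
  [set p | [/\ unit_itv p.1, unit_itv p.2 &
            exists2 w, Omega w & p.2 = w * p.1]].

Definition Omega4 (R : realType) : set R := [set 2^-1; 3; 3^-1; 2].
Definition Omega5 (R : realType) : set R := [set 2^-1; 3; 3^-1; 2; 1].
Arguments Omega4 : clear implicits.
Arguments Omega5 : clear implicits.

Definition homeomorphism (X Y : topologicalType) (f : X -> Y) : Prop :=
  continuous f /\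
  exists g : Y -> X, [/\ continuous g, cancel f g & cancel g f].

Section ContinuumTheory.
Context {R : realType} {X : metricType R}.
Implicit Types (A B : set X) (a b v x : X).

Definition continuum_set A : Prop := [/\ A !=set0, compact A & connected A].

Definition unicoherent_set A : Prop := forall B C,
  continuum_set B -> continuum_set C -> B `|` C = A -> connected (B `&` C).

Definition hereditarily_unicoherent : Prop :=
  forall A, continuum_set A -> unicoherent_set A.

(* [h] is a homeomorphism of [0, 1] onto [A], with inverse [g]. *)
Definition is_arc A a b : Prop :=
  exists (h : R -> X) (g : X -> R),
    [/\ {within unit_itv (R := R), continuous h}, {within A, continuous g},
        h @` unit_itv (R := R) = A &
        forall t, unit_itv t -> g (h t) = t] /\
    h 0 = a /\ h 1 = b.

Definition arcwise_connected : Prop :=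
  forall a b, a <> b -> exists A, is_arc A a b.

Definition endpoint x : Prop :=
  forall A a b, is_arc A a b -> A x -> x = a \/ x = b.

(* [x] is the common end of three arcs that are otherwise disjoint. *)
Definition ramification_point x : Prop :=
  exists (A B C : set X) (a b c : X),
    [/\ is_arc A x a, is_arc B x b & is_arc C x c] /\
    [/\ A `&` B = [set x], B `&` C = [set x] & A `&` C = [set x]].

(* The arc from [v] to itself is the degenerate one, {v}. *)
Definition arc_or_point A v x : Prop := (v = x /\ A = [set v]) \/ is_arc A v x.

Definition hausdorff_dist A B : R :=
  inf [set e : R | [/\ 0 < e,
    forall a, A a -> exists2 b, B b & mdist a b < e &
    forall b, B b -> exists2 a, A a & mdist a b < e]].

(* Meant for a fan with top [v], where the arcs quantified over are unique. *)
Definition smooth_at v : Prop :=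
  forall (u : nat -> X) x, u n @[n --> \oo] --> x ->
  forall (A_ : nat -> set X) A,
    (forall n, arc_or_point (A_ n) v (u n)) -> arc_or_point A v x ->
    hausdorff_dist (A_ n) A @[n --> \oo] --> (0 : R).

Definition fan_with_top v : Prop :=
  [/\ continuum_set [set: X], arcwise_connected, hereditarily_unicoherent &
      forall x, ramification_point x <-> x = v].

End ContinuumTheory.

Definition Lelek_fan (R : realType) (X : metricType R) : Prop :=
  exists v : X, [/\ fan_with_top v, smooth_at v & dense [set x : X | endpoint x]].

Section Dynamics.
Context {R : realType} {Y : metricType R} (f : Y -> Y).

Definition transitive_map : Prop :=
  forall U V : set Y, open U -> open V -> U !=set0 -> V !=set0 ->
  exists n, (iter n f @` U) `&` V !=set0.

Definition topologically_mixing : Prop :=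
  forall U V : set Y, open U -> open V -> U !=set0 -> V !=set0 ->
  exists n0, forall n, (n0 <= n)%N -> (iter n f @` U) `&` V !=set0.

Definition periodic_point (x : Y) : Prop :=
  exists2 n, (0 < n)%N & iter n f x = x.

Definition sensitive : Prop :=
  exists2 c : R, 0 < c & forall x (U : set Y), nbhs x U ->
    exists2 y, U y & exists n, c < mdist (iter n f x) (iter n f y).

Definition Devaney_chaotic : Prop :=
  [/\ transitive_map, dense [set x | periodic_point x] & sensitive].

Definition shadowing : Prop :=
  forall eps : R, 0 < eps -> exists2 delta : R, 0 < delta &
  forall x : nat -> Y, (forall k, mdist (f (x k)) (x k.+1) < delta) ->
  exists y, forall k, mdist (iter k f y) (x k) < eps.

(* Only the values of [x], [k], [l] at indices 1, ..., n are used; the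
   condition k_(j+1) - l_j >= N is written without subtraction. *)
Definition specification : Prop :=
  forall eps : R, 0 < eps -> exists2 N : nat, (0 < N)%N &
  forall (n : nat) (x : nat -> Y) (k l : nat -> nat), (1 <= n)%N ->
    (forall j, (1 <= j <= n)%N -> (k j <= l j)%N) ->
    (forall j, (1 <= j < n)%N -> (l j + N <= k j.+1)%N) ->
  exists y, forall i j, (1 <= i <= n)%N -> (k i <= j <= l i)%N ->
    mdist (iter j f y) (iter j f (x i)) <= eps.

End Dynamics.

(* Main.v *)
(* A nonzero point of a Mahavier product of lines is determined by its sequence of
   slopes and by its value at 0, so the space is a cone, with top the zero
   sequence, over a space of slope sequences. Away from the top the slopes are
   locally constant. Hence a connected set avoiding the top lies on one ray, and a
   subcontinuum contains, with two points of a ray, all the points between them.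
   Therefore two subcontinua have a connected intersection, the arcs from the top
   are the ray segments, and a point other than the top has at most two directions
   in which an arc can leave it. A point with a coordinate equal to 1 is the upper
   end of its ray.

   For the dynamics, log 2 and log 3 are incommensurable, so that from every
   positive value one reaches, dividing first and multiplying afterwards, values
   slightly below any prescribed v in (0, 1]; rescaling a given orbit by a factor
   close to 1 then makes it start at the value reached. With the slope 1 one can
   also wait, and the connecting time becomes uniform for values bounded away from
   0, which gives specification. The set of slopes is closed under inverses, so
   orbits can be run backwards: periodic points are dense, and the two-sided shift
   is mapped onto the one-sided one. Shadowing fails for slowly growing multiples
   of an orbit with alternating slopes 1/2 and 2. *)
Require Import Defs.
From HB Require Import structures.
From mathcomp Require Import all_boot all_order all_algebra.
From mathcomp Require Import all_classical all_reals all_analysis.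
From mathcomp Require Import zify ring lra.

Set Implicit Arguments.
Unset Strict Implicit.
Unset Printing Implicit Defensive.

Import Order.TTheory GRing.Theory Num.Theory.
Import numFieldNormedType.Exports.

Local Open Scope classical_set_scope.
Local Open Scope ring_scope.

Lemma unit_itvP (R : realType) (t : R) : unit_itv t <-> 0 <= t <= 1.
Proof. by rewrite /unit_itv /= in_itv. Qed.

(** * Truncation to the unit interval *)

Section Clamp.
Context {R : realType}.
Implicit Types c d : R.

Definition clamp c : R := Num.max 0 (Num.min 1 c).

Lemma clamp_itv c : 0 <= clamp c <= 1.
Proof. by rewrite /clamp /Num.max /Num.min; do ! case: ifP; lra. Qed.

Lemma clamp_id c : 0 <= c <= 1 -> clamp c = c.
Proof. by rewrite /clamp /Num.max /Num.min; do ! case: ifP; lra. Qed.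

Lemma clamp_le0 c : c <= 0 -> clamp c = 0.
Proof. by rewrite /clamp /Num.max /Num.min; do ! case: ifP; lra. Qed.

Lemma clamp_lip c d : `|clamp c - clamp d| <= `|c - d|.
Proof.
have h (x y : R) : x <= y -> clamp y - clamp x <= y - x /\ 0 <= clamp y - clamp x.
  by rewrite /clamp /Num.max /Num.min; do ! case: ifP; lra.
have [cd|/ltW cd] := leP c d.
  by rewrite distrC (distrC c) !ger0_norm ?subr_ge0 //; have := h _ _ cd; lra.
by rewrite !ger0_norm ?subr_ge0 //; have := h _ _ cd; lra.
Qed.

End Clamp.

(** * Arcs in metric spaces *)

Section MetricLemmas.
Context {R : realType} {X : metricType R}.

Lemma lipschitz_continuous {Y : metricType R} (K : R) (f : X -> Y) :
  (forall x y, mdist (f x) (f y) <= K * mdist x y) -> continuous f.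
Proof.
move=> fK x; apply/cvg_ballP => e e0.
(* [K] may be zero or negative, so the division uses a positive bound for it. *)
have K0 : 0 < `|K| + 1 by rewrite ltr_wpDl.
near=> y; rewrite ballEmdist /=; apply: le_lt_trans (fK x y) _.
apply: (@le_lt_trans _ _ ((`|K| + 1) * mdist x y)).
  by rewrite ler_wpM2r ?mdist_ge0 // (le_trans (ler_norm K)) // lerDl.
rewrite mulrC -ltr_pdivlMr //.
have : ball x (e / (`|K| + 1)) y.
  by near: y; apply: nbhsx_ballx; rewrite divr_gt0.
by rewrite ballEmdist.
Unshelve. all: by end_near. Qed.

Lemma real_lipschitz_continuous (K : R) (f : X -> R) :
  (forall x y, `|f x - f y| <= K * mdist x y) -> continuous f.
Proof.
move=> fK x; apply/cvgrPdist_lt => e e0.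
have K0 : 0 < `|K| + 1 by rewrite ltr_wpDl.
near=> y; apply: le_lt_trans (fK x y) _.
apply: (@le_lt_trans _ _ ((`|K| + 1) * mdist x y)).
  by rewrite ler_wpM2r ?mdist_ge0 // (le_trans (ler_norm K)) // lerDl.
rewrite mulrC -ltr_pdivlMr //.
have : ball x (e / (`|K| + 1)) y.
  by near: y; apply: nbhsx_ballx; rewrite divr_gt0.
by rewrite ballEmdist.
Unshelve. all: by end_near. Qed.

Lemma lipschitz_real_continuous (K : R) (f : R -> X) :
  (forall s t, mdist (f s) (f t) <= K * `|s - t|) -> continuous f.
Proof.
move=> fK x; apply/cvg_ballP => e e0.
have K0 : 0 < `|K| + 1 by rewrite ltr_wpDl.
near=> y; rewrite ballEmdist /=; apply: le_lt_trans (fK x y) _.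
apply: (@le_lt_trans _ _ ((`|K| + 1) * `|x - y|)).
  by rewrite ler_wpM2r // (le_trans (ler_norm K)) // lerDl.
rewrite mulrC -ltr_pdivlMr //.
near: y; apply/nbhs_normP; exists (e / (`|K| + 1)) => //=.
by rewrite divr_gt0.
Unshelve. all: by end_near. Qed.

(* A continuous injection of the compact interval is a closed map, so its
   inverse is continuous. *)
Lemma is_arc_of_injective (h : R -> X) :
  {within unit_itv (R := R), continuous h} ->
  (forall s t, unit_itv s -> unit_itv t -> h s = h t -> s = t) ->
  is_arc (h @` unit_itv (R := R)) (h 0) (h 1).
Proof.
move=> hc hinj; pose g y := xget 0 [set t | unit_itv t /\ h t = y].
have gh t : unit_itv t -> g (h t) = t.
  move=> ut; rewrite /g; case: xgetP => [s _ [us hst]|/(_ t)].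
    exact: hinj.
  by case.
exists h, g; split => //; split => //.
apply/continuous_closedP => W cW; apply/closed_subspaceP.
exists (h @` (unit_itv (R := R) `&` W)); last first.
  rewrite eqEsubset; split => [x [[t [ut Wt] <-] _]|x [/= Wx [t ut htx]]].
    by split; [rewrite /preimage /= /from_subspace gh|exists t].
  by subst x; rewrite /from_subspace gh // in Wx; split; exists t.
apply: compact_closed; first exact: metric_hausdorff.
apply: continuous_compact.
  by apply: continuous_subspaceW hc => t [].
by apply: compact_closedI => //; exact: segment_compact.
Qed.

Lemma is_arc_continuum (A : set X) a b : is_arc A a b ->
  [/\ continuum_set A, A a & A b].
Proof.
move=> [h [g [[hc gc <- gh] [<- <-]]]]; split.
- split; first by exists (h 0), 0 => //; apply/unit_itvP; lra.
  + by apply: continuous_compact => //; exact: segment_compact.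
  + by apply: connected_continuous_connected => //; exact: segment_connected.
- by exists 0 => //; apply/unit_itvP; lra.
- by exists 1 => //; apply/unit_itvP; lra.
Qed.

(* The preimage of B in the unit interval is connected and contains 0 and 1. *)
Lemma is_arc_irreducible (A B : set X) a b : is_arc A a b -> connected B ->
  B `<=` A -> B a -> B b -> A `<=` B.
Proof.
move=> [h [g [[hc gc hA gh] [ha hb]]]] cB BA Ba Bb.
have cgB : connected (g @` B).
  by apply: connected_continuous_connected => //; apply: continuous_subspaceW gc.
have u0 : unit_itv (0 : R) by apply/unit_itvP; lra.
have u1 : unit_itv (1 : R) by apply/unit_itvP; lra.
move/connected_intervalP : cgB => igB.
rewrite -hA => _ [t ut <-].
have gB0 : (g @` B) 0 by exists a => //; rewrite -ha gh.
have gB1 : (g @` B) 1 by exists b => //; rewrite -hb gh.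
have [y By gyt] := igB 0 1 gB0 gB1 t (iffLR (unit_itvP t) ut).
have := BA _ By; rewrite -hA => -[s us hs].
by move: gyt; rewrite -hs gh // => <-; rewrite hs.
Qed.

End MetricLemmas.

Lemma exists_expn_lt (R : realType) (e : R) : 0 < e -> exists N, 2 ^- N < e.
Proof.
move=> e0; have [N _ /(_ N (leqnn N)) /= NP] := near_infty_natSinv_expn_lt (PosNum e0).
by exists N; move: NP; rewrite /= mul1r.
Qed.

Lemma finite_near (T : Type) (J : choiceType) (F : set_system T) (D : set J)
    (P : J -> T -> Prop) : Filter F -> finite_set D ->
  (forall j, D j -> \forall x \near F, P j x) ->
  \forall x \near F, forall j, D j -> P j x.
Proof.
move=> FF /finite_seqP [s ->]; elim: s => [|j s IH] h.
  by apply: nearW => x j.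
have hj : \forall x \near F, P j x by apply: h; rewrite /= inE eqxx.
have hs : \forall x \near F, forall i, [set` s] i -> P i x.
  by apply: IH => i si; apply: h; rewrite /= inE; apply/orP; right.
near=> x => i; rewrite /= inE => /orP[/eqP ->|]; first by near: x.
by move: i; near: x.
Unshelve. all: by end_near. Qed.

(** * Spaces of rays with finitely many ratios in each coordinate *)

Section Fan.
(** One abstract setting serves both the one-sided and the two-sided product: [co] gives the
    coordinates, [j0] is a base coordinate that vanishes only at the top, and [D j] contains the
    finitely many possible ratios of coordinate [j] to coordinate [j0]. *)
Context {R : realType} {X : metricType R} {J : choiceType} (j0 : J)
  (w : J -> nat) (co : X -> J -> R) (scale : R -> X -> X) (D : J -> set R).

Hypothesis co_unit : forall x j, 0 <= co x j <= 1.
Hypothesis mdistE : forall x y, mdist x y = wsup_dist w (co x) (co y).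
Hypothesis window_finite : forall N, finite_set [set j | (w j <= N)%N].
Hypothesis D_finite : forall j, finite_set (D j).
Hypothesis co_ratio : forall x j, exists2 d, D j d & co x j = d * co x j0.
(* The clamp makes scaling total and continuous in its factor. *)
Hypothesis co_scale : forall c x j, co (scale c x) j = clamp c * co x j.
(** This amounts to closedness of the space in the cube, from which compactness follows. *)
Hypothesis co_complete : forall (F : set_system X), ProperFilter F ->
  forall l : J -> R, (forall j, co x j @[x --> F] --> l j) ->
  exists x, co x = l.
Variable o : X.
Hypothesis co_o : forall j, co o j = 0.

Implicit Types (x y z : X) (c d : R) (B C : set X).

(** * Coordinates, metric and compactness *)

Lemma co_cube x j : unit_itv (co x j).
Proof. exact/unit_itvP. Qed.

Lemma co_ge0 x j : 0 <= co x j.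
Proof. by have /andP[] := co_unit x j. Qed.

Lemma co_le1 x j : co x j <= 1.
Proof. by have /andP[] := co_unit x j. Qed.

Lemma co_inj x y : (forall j, co x j = co y j) -> x = y.
Proof.
move=> /funext xy; apply: mdist_positivity; rewrite mdistE xy.
exact: (wsup_distxx j0 _ (co_cube y)).
Qed.

Lemma co_dist x y j : `|co x j - co y j| <= 2 ^+ w j * mdist x y.
Proof.
rewrite mulrC -ler_pdivrMr ?exprn_gt0 // mdistE.
exact: (wsup_ub j0 w (co_cube x) (co_cube y)).
Qed.

Lemma co_continuous j : continuous (co ^~ j).
Proof. by apply: (@real_lipschitz_continuous _ _ (2 ^+ w j)) => x y; exact: co_dist. Qed.

Lemma mdist_le_coord x y e :
  (forall j, `|co x j - co y j| <= e) -> mdist x y <= e.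
Proof.
move=> xy; rewrite mdistE; apply: (wsup_lub j0 (co_cube x) (co_cube y)) => j.
rewrite (le_trans _ (xy j)) // ler_pdivrMr ?exprn_gt0 //.
by rewrite ler_peMr // exprn_ege1 // ler1n.
Qed.

(** Coordinates of weight index above [N] contribute at most 2^-N, as they lie in the unit
    interval. *)
Lemma mdist_le_window x y N e : 2 ^- N <= e ->
  (forall j, (w j <= N)%N -> `|co x j - co y j| <= e) -> mdist x y <= e.
Proof.
move=> Ne xy; rewrite mdistE; apply: (wsup_lub j0 (co_cube x) (co_cube y)) => j.
have [/xy xyj|/ltnW Nj] := leqP (w j) N.
  rewrite (le_trans _ xyj) // ler_pdivrMr ?exprn_gt0 //.
  by rewrite ler_peMr // exprn_ege1 // ler1n.
apply: le_trans Ne.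
rewrite ler_pdivrMr ?exprn_gt0 //.
apply: (@le_trans _ _ 1).
  by have := co_unit x j; have := co_unit y j; rewrite ler_norml; lra.
by rewrite mulrC ler_pdivlMr ?exprn_gt0 // mul1r ler_weXn2l // ler1n.
Qed.

(** Up to a given error only the finitely many coordinates of a window matter. *)
Lemma co_cvg (F : set_system X) x : Filter F ->
  (forall j, co y j @[y --> F] --> co x j) -> F --> x.
Proof.
move=> FF Fx; apply/cvg_ballP => e e0.
have [N Ne] := exists_expn_lt (divr_gt0 e0 (ltr0n _ 2)).
have : \forall y \near F, forall j, (w j <= N)%N -> `|co x j - co y j| < e / 2.
  apply: finite_near (window_finite N) _ => j _.
  by move/cvgrPdist_lt : (Fx j); apply; lra.
apply: filterS => y xy; rewrite ballEmdist /=.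
apply: le_lt_trans (@mdist_le_window x y N (e / 2) (ltW Ne) _) _; last by lra.
by move=> j /xy/ltW.
Qed.

Lemma scale1 x : scale 1 x = x.
Proof. by apply: co_inj => j; rewrite co_scale clamp_id ?mul1r //; lra. Qed.

Lemma scale0 x : scale 0 x = o.
Proof. by apply: co_inj => j; rewrite co_scale co_o clamp_id ?mul0r //; lra. Qed.

Lemma scaleo c : scale c o = o.
Proof. by apply: co_inj => j; rewrite co_scale co_o mulr0. Qed.

Lemma scale_dist c x y : mdist (scale c x) (scale c y) <= mdist x y.
Proof.
rewrite [leLHS]mdistE; apply: (wsup_lub j0 (co_cube _) (co_cube _)) => j.
have := co_dist x y j; have /andP[c0 c1] := clamp_itv c.
rewrite !co_scale -mulrBr normrM ger0_norm // => h.
rewrite ler_pdivrMr ?exprn_gt0 // [leRHS]mulrC.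
by rewrite (le_trans _ h) // ler_piMl.
Qed.

Lemma scale_lip x c d : mdist (scale c x) (scale d x) <= 1 * `|c - d|.
Proof.
rewrite mul1r; apply: mdist_le_coord => j; rewrite !co_scale -mulrBl normrM.
rewrite (ger0_norm (co_ge0 _ _)); apply: le_trans (clamp_lip c d).
by rewrite ler_piMr // co_le1.
Qed.

Lemma scale_continuous x : continuous (scale ^~ x).
Proof. by apply: lipschitz_real_continuous => s t; exact: scale_lip. Qed.

Lemma co_j0_eq0 x : co x j0 = 0 -> x = o.
Proof.
move=> x0; apply: co_inj => j; rewrite co_o.
by have [d _ ->] := co_ratio x j; rewrite x0 mulr0.
Qed.

Lemma co_j0_gt0 x : x <> o -> 0 < co x j0.
Proof.
move=> xo; rewrite lt_neqAle co_ge0 andbT eq_sym.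
by apply/eqP => /co_j0_eq0.
Qed.

(** Along an ultrafilter every coordinate converges in the unit interval, and [co_complete]
    assembles the limits into a point. *)
Lemma fan_compact : compact [set: X].
Proof.
rewrite compact_ultra => F FF _.
have PF : ProperFilter F by exact: ultra_proper.
have lim j : exists l : R, co x j @[x --> F] --> l.
  have F01 : fmap (co ^~ j) F `[0, 1]%classic.
    by apply: (@filterE _ F) => x; exact: co_cube.
  have [l [_ Fl]] := @segment_compact R 0 1 (fmap (co ^~ j) F) _ F01.
  (* A cluster point of an ultrafilter is a limit: otherwise the complement of a ball around it
     would belong to the ultrafilter. *)
  exists l; apply/cvgrPdist_lt => e e0.
  have [//|Fc] := in_ultra_setVsetC [set x | `|l - co x j| < e] FF.
  have [r []] := Fl (~` (ball l e)) (ball l e) Fc (nbhsx_ballx l e e0).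
  by [].
have [l lP] := choice lim.
have [x xl] := co_complete PF lP.
by exists x; split => //; apply: co_cvg => j; rewrite xl.
Qed.

(** * Collinear points and constancy of ratios on connected sets *)

Definition collinear x y := forall j, co x j * co y j0 = co y j * co x j0.

Lemma collinear_sym x y : collinear x y -> collinear y x.
Proof. by move=> xy j; rewrite xy. Qed.

Lemma collinear_scale c x : collinear x (scale c x).
Proof. by move=> j; rewrite !co_scale; ring. Qed.

Lemma collinear_le x y : collinear x y -> co x j0 <= co y j0 ->
  exists2 c, 0 <= c <= 1 & x = scale c y.
Proof.
move=> xy xy0; have [yo|yo] := pselect (y = o).
  exists 1; first by lra.
  rewrite scale1 yo; apply: co_j0_eq0; have := co_ge0 x j0.
  by move: xy0; rewrite yo co_o; lra.
have y0 := co_j0_gt0 yo.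
have c01 : 0 <= co x j0 / co y j0 <= 1.
  by rewrite divr_ge0 ?co_ge0 //= ler_pdivrMr ?mul1r.
exists (co x j0 / co y j0) => //.
apply: co_inj => j; rewrite co_scale clamp_id //.
by rewrite mulrAC (mulrC (co x j0)) -xy mulfK // gt_eqF.
Qed.

(** The top is collinear with every point, hence the condition on the middle point. *)
Lemma collinear_trans x y z : y <> o -> collinear x y -> collinear y z ->
  collinear x z.
Proof.
move=> /co_j0_gt0 y0 xy yz j; apply: (@mulIf _ (co y j0)); first by rewrite gt_eqF.
by rewrite mulrAC xy mulrAC yz; ring.
Qed.

(** These closed sets meet only in the top for different [d]. For fixed [j] those with [d] in [D j]
    cover the space, so away from the top each of them is also relatively open. *)
Definition ratio_set j d : set X := [set z | co z j - d * co z j0 = 0].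

Lemma ratio_set_closed j d : closed (ratio_set j d).
Proof.
apply: (@preimage_closed _ _ (fun z => co z j - d * co z j0) [set x : R | x = 0]);
  last exact: closed_eq.
move=> z _; apply: cvgB; first exact: co_continuous.
by apply: cvgM; [exact: cvg_cst|exact: co_continuous].
Qed.

Lemma ratio_set_unique j d e z : ratio_set j d z -> ratio_set j e z ->
  z <> o -> d = e.
Proof.
rewrite /ratio_set /= => zd ze /co_j0_gt0 z0.
have : (e - d) * co z j0 = 0 by rewrite mulrBl; lra.
by move/eqP; rewrite mulf_eq0 subr_eq0 (gt_eqF z0) orbF => /eqP.
Qed.

(* On a connected set that avoids the top, all the ratios, which take finitely
   many values, are constant. *)
Lemma connected_collinear C x y : connected C -> ~ C o -> C x -> C y ->
  collinear x y.
Proof.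
move=> cC Co Cx Cy j.
have [d Dd xd] := co_ratio x j.
have CE : C `&` ratio_set j d = C.
  apply: cC; first by exists x; split => //; rewrite /ratio_set /= xd subrr.
    exists (~` \bigcup_(e in D j `\ d) ratio_set j e).
      apply: closed_openC; apply: closed_bigcup => [|e _].
        exact: sub_finite_set (D_finite j).
      exact: ratio_set_closed.
    rewrite eqEsubset; split => z [Cz] => [zd|nz]; split => //.
      move=> [e [_ /= ed]] ze; apply/ed/(ratio_set_unique ze zd).
      by move=> zo; apply: Co; rewrite -zo.
    have [e De ze] := co_ratio z j.
    have [<-|ed] := pselect (e = d); first by rewrite /ratio_set /= ze subrr.
    by exfalso; apply: nz; exists e => //; rewrite /ratio_set /= ze subrr.
  by exists (ratio_set j d) => //; exact: ratio_set_closed.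
have : ratio_set j d y by rewrite -CE in Cy; case: Cy.
by rewrite /ratio_set /= xd => /subr0_eq ->; ring.
Qed.

(* If the segment from scale a x to x left C at scale b x, then in C the points
   that have the same ratios as x on a large window and that lie above scale b x
   would form a clopen set. *)
Lemma continuum_ray_convex C x a b : closed C -> connected C -> C x ->
  C (scale a x) -> 0 <= a -> a <= b -> b <= 1 -> C (scale b x).
Proof.
move=> clC cC Cx Cax a0 ab b1; apply: contrapT => nCb.
have [xo|xo] := pselect (x = o); first by apply: nCb; rewrite xo scaleo -xo.
have x0 := co_j0_gt0 xo.
have b01 : 0 <= b <= 1 by lra.
have : nbhs (scale b x) (~` C).
  by apply: open_nbhs_nbhs; split => //; exact: closed_openC.
move=> /nbhs_ballP [e /= e0]; rewrite ballEmdist /= => bC.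
have e2 : e / 2 < e by have := e0 : 0 < e; lra.
have [N Ne] := exists_expn_lt (divr_gt0 e0 (ltr0n _ 2)).
have /choice [r rP] : forall j, exists d, D j d /\ co x j = d * co x j0.
  by move=> j; have [d Dd xd] := co_ratio x j; exists d.
pose W := [set j | (w j <= N)%N].
(* [V] is open, [K] is closed, and they agree on [C]: away from the top a prescribed ratio is an
   open condition, and equality of levels is ruled out by the ball around [scale b x] that misses
   [C]. *)
pose V := [set z | b * co x j0 < co z j0] `&`
  ~` \bigcup_(j in W) \bigcup_(d in D j `\ r j) ratio_set j d.
pose K := [set z | b * co x j0 <= co z j0] `&` \bigcap_(j in W) ratio_set j (r j).
have Cpos z : b * co x j0 < co z j0 -> z <> o.
  move=> zx zo; have : 0 <= b * co x j0 by apply: mulr_ge0; lra.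
  by move: zx; rewrite zo co_o; lra.
have b1' : b < 1.
  rewrite lt_neqAle b1 andbT; apply/eqP => bE; apply: nCb.
  by rewrite bE scale1.
have VK : C `&` V = C `&` K.
  rewrite eqEsubset; split => z [Cz [zx zN]]; split => //.
    split; first exact: ltW.
    move=> j Wj; have [d Dd zd] := co_ratio z j.
    have [<-|dr] := pselect (d = r j); first by rewrite /ratio_set /= zd subrr.
    exfalso; apply: zN; exists j => //; exists d => //.
    by rewrite /ratio_set /= zd subrr.
  have {}zx : b * co x j0 < co z j0.
    rewrite lt_neqAle; apply/andP; split => //; apply/eqP => zxE.
    apply: bC Cz => /=; apply: (le_lt_trans (mdist_le_window (ltW Ne) _) e2).
    move=> j Wj; have := zN j Wj; rewrite /ratio_set /= -zxE => /subr0_eq ->.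
    rewrite co_scale clamp_id // (rP j).2 mulrCA subrr normr0.
    by rewrite divr_ge0 ?ltW.
  split => // -[j Wj [d [_ dr] zd]].
  by apply: dr; apply: ratio_set_unique zd (zN j Wj) (Cpos _ zx).
have Vx : V x.
  split; first by rewrite /= gtr_pMl.
  move=> [j Wj [d [_ dr] xd]]; apply: dr; apply: ratio_set_unique xd _ xo.
  by rewrite /ratio_set /= (rP j).2 subrr.
have CV : C `&` V = C.
  apply: cC; first by exists x.
    exists V => //; apply: openI.
      apply: (@open_comp _ _ (co ^~ j0) [set t : R | b * co x j0 < t]).
        by move=> z _; exact: co_continuous.
      exact: open_gt.
    apply: closed_openC; apply: closed_bigcup => [|j _]; first exact: window_finite.
    apply: closed_bigcup => [|d _]; last exact: ratio_set_closed.
    exact: sub_finite_set (D_finite j).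
  exists K => //; apply: closedI.
    apply: (@preimage_closed _ _ (co ^~ j0) [set t : R | b * co x j0 <= t]).
      by move=> z _; exact: co_continuous.
    exact: closed_ge.
  by apply: closed_bigI => j _; exact: ratio_set_closed.
(* By connectedness all of [C] lies above the level of [scale b x], yet [scale a x] does not. *)
have [_ [/=]] : (C `&` V) (scale a x) by rewrite CV.
rewrite co_scale clamp_id; last by lra.
by rewrite ltr_pM2r // ltNge ab.
Qed.

(** * Ray segments and intersections of subcontinua *)

Definition piece x a b : set X := scale ^~ x @` `[a, b]%classic.

Lemma piece_connected x a b : connected (piece x a b).
Proof.
apply: connected_continuous_connected; first exact: segment_connected.
by apply: continuous_subspaceT; exact: scale_continuous.
Qed.

Lemma piece_end x a b : a <= b -> piece x a b (scale a x) /\ piece x a b (scale b x).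
Proof.
by move=> ab; split; [exists a|exists b] => //=; rewrite in_itv /=; lra.
Qed.

Lemma connected_joined B :
  (forall x y, B x -> B y ->
    exists C, [/\ connected C, C x, C y & C `<=` B]) -> connected B.
Proof.
move=> BC; have [->|/set0P[x Bx]] := eqVneq B set0; first exact: connected0.
suff -> : B = \bigcup_(C in [set C | [/\ connected C, C x & C `<=` B]]) C.
  apply: bigcup_connected; last by move=> C [].
  by exists x => C [].
rewrite eqEsubset; split => [y By|y [C [_ _ CB] Cy]]; last exact: CB.
by have [C [cC Cx Cy CB]] := BC x y Bx By; exists C.
Qed.

Lemma continuum_closed C : continuum_set C -> closed C.
Proof. by case=> _ cC _; apply: compact_closed => //; exact: metric_hausdorff. Qed.

Lemma continuum_piece C x a : continuum_set C -> C x -> C (scale a x) ->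
  0 <= a -> piece x a 1 `<=` C.
Proof.
move=> /[dup] /continuum_closed clC [_ _ cC] Cx Cax a0 _ [d dab <-].
move: dab; rewrite /= in_itv /= => /andP[ad d1].
exact: (@continuum_ray_convex C x a d).
Qed.

Lemma fan_connected B : B o -> (forall x, B x -> piece x 0 1 `<=` B) -> connected B.
Proof.
move=> Bo Bp; apply: connected_joined => x y Bx By.
have px z : piece z 0 1 o /\ piece z 0 1 z.
  by have := @piece_end z 0 1 ler01; rewrite scale0 scale1.
exists (piece x 0 1 `|` piece y 0 1); split.
- apply: connectedU; [exists o|exact: piece_connected|exact: piece_connected].
  by split; apply: (px _).1.
- by left; apply: (px _).2.
- by right; apply: (px _).2.
- by rewrite subUset; split; exact: Bp.
Qed.

Lemma continua_setI_connected B C : continuum_set B -> continuum_set C ->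
  connected (B `&` C).
Proof.
wlog Bo : B C / ~ B o => [hw|].
  (* If both continua contain the top, their intersection is star-shaped about it. Otherwise one of
     them avoids the top and, by symmetry, may be called [B]; it lies on a single ray. *)
  have [Bo|] := pselect (B o); last exact: hw.
  have [Co|nCo] := pselect (C o); last by rewrite setIC => hB hC; exact: hw.
  move=> hB hC; apply: fan_connected => // x [Bx Cx] y xy; split.
    by apply: (continuum_piece hB Bx) xy; rewrite ?scale0.
  by apply: (continuum_piece hC Cx) xy; rewrite ?scale0.
move=> hB hC; apply: connected_joined.
have key x y : (B `&` C) x -> (B `&` C) y -> co x j0 <= co y j0 ->
    exists D0 : set X, [/\ connected D0, D0 x, D0 y & D0 `<=` B `&` C].
  move=> [Bx Cx] [By Cy] xy.
  have [_ _ cB] := hB.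
  have [c c01 xE] := collinear_le (connected_collinear cB Bo Bx By) xy.
  have c1 : c <= 1 by lra.
  have [p1 p2] := piece_end y c1.
  exists (piece y c 1); split => //; first exact: piece_connected.
  - by rewrite xE.
  - by rewrite scale1 in p2.
  - have c0 : 0 <= c by lra.
    move=> z yz; split.
      by apply: (continuum_piece hB By) yz => //; rewrite -xE.
    by apply: (continuum_piece hC Cy) yz => //; rewrite -xE.
move=> x y Bx By; have [xy|/ltW yx] := leP (co x j0) (co y j0).
  exact: key.
by have [E [? ? ? ?]] := key y x By Bx yx; exists E.
Qed.

Lemma fan_continuum : continuum_set [set: X].
Proof.
split; [by exists o|exact: fan_compact|].
by apply: fan_connected.
Qed.

Lemma fan_hereditarily_unicoherent : @hereditarily_unicoherent R X.
Proof. by move=> A _ B C hB hC _; exact: continua_setI_connected. Qed.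

(** * Directions in which an arc leaves a point *)

Definition descends C x := exists2 c, 0 <= c < 1 & piece x c 1 `<=` C.

Definition ascends C x := exists y c, [/\ y <> x, 0 <= c <= 1, x = scale c y &
  piece y c 1 `<=` C].

(** The larger of the two factors gives a common point below [x]. *)
Lemma descends_meet B C x : x <> o -> descends B x -> descends C x ->
  exists p, [/\ p <> x, B p & C p].
Proof.
move=> xo [b b01 Bb] [c c01 Cc].
exists (scale (Num.max b c) x); split.
- move=> /(congr1 (co ^~ j0)); rewrite /= co_scale clamp_id; last first.
    by rewrite /Num.max; case: ifP; lra.
  have := co_j0_gt0 xo; have : Num.max b c < 1 by rewrite /Num.max; case: ifP; lra.
  by nra.
- by apply: Bb; exists (Num.max b c) => //=; rewrite in_itv /= /Num.max; case: ifP; lra.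
- by apply: Cc; exists (Num.max b c) => //=; rewrite in_itv /= /Num.max; case: ifP; lra.
Qed.

(** Both upper points lie on the ray of [x], and the lower of the two belongs to both segments. *)
Lemma ascends_meet B C x : x <> o -> ascends B x -> ascends C x ->
  exists p, [/\ p <> x, B p & C p].
Proof.
move=> xo [y [b [yx b01 xy Bb]]] [z [c [zx c01 xz Cc]]].
wlog yz : B C y z b c yx b01 xy Bb zx c01 xz Cc / co y j0 <= co z j0.
  move=> hw; have [yz|/ltW zy] := leP (co y j0) (co z j0).
    exact: (hw B C y z b c).
  by have [p [? ? ?]] := hw C B z y c b zx c01 xz Cc yx b01 xy Bb zy; exists p.
have cxy : collinear y x by rewrite xy; exact: collinear_scale.
have cxz : collinear x z by rewrite xz; apply/collinear_sym/collinear_scale.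
have [d d01 yE] := collinear_le (collinear_trans xo cxy cxz) yz.
have x0 := co_j0_gt0 xo.
have y0 : co x j0 = b * co y j0 by rewrite xy co_scale clamp_id.
have z0 : co x j0 = c * co z j0 by rewrite xz co_scale clamp_id.
have yd : co y j0 = d * co z j0 by rewrite yE co_scale clamp_id.
exists y; split => //.
  apply: Bb; exists 1; rewrite ?scale1 //= in_itv /=; lra.
apply: Cc; exists d => //=; rewrite in_itv /=.
have zpos : 0 < co z j0.
  by apply: co_j0_gt0 => zo; apply: xo; rewrite xz zo scaleo.
have : c * co z j0 <= d * co z j0.
  by rewrite -z0 -yd y0 ler_piMl ?co_ge0 //; lra.
by rewrite ler_pM2r //; lra.
Qed.

(** A subarc from [h s] to some [h r] that avoids the top stays on one ray. It is a continuum, so it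
    contains the ray segment between its ends, which lies below or above [h s]. *)
Lemma arc_leaves (h : R -> X) (s t : R) :
  {within unit_itv (R := R), continuous h} ->
  (forall u v, unit_itv u -> unit_itv v -> h u = h v -> u = v) ->
  unit_itv s -> unit_itv t -> s <> t -> h s <> o ->
  descends (h @` `[Num.min s t, Num.max s t]%classic) (h s) \/
  ascends (h @` `[Num.min s t, Num.max s t]%classic) (h s).
Proof.
move=> hc hinj us ut st hso.
pose I (a b : R) := `[Num.min a b, Num.max a b]%classic : set R.
have IE a b u : I a b u <-> (a <= u <= b \/ b <= u <= a).
  by rewrite /I /= in_itv /= /Num.min /Num.max; case: ifP; lra.
(* The arc is cut short before it meets the top: by injectivity this happens at one parameter at
   most, and the midpoint between [s] and that parameter serves as [r]. *)
have [r [ur rs Irt Ir]] : exists r, [/\ unit_itv r, r <> s,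
    I s r `<=` I s t & ~ (h @` I s r) o].
  have [[u Iu hu]|nIo] := pselect ((h @` I s t) o); last first.
    by exists t; split => // ts; apply: st.
  have us' : u <> s by move=> us'; apply: hso; rewrite -us'.
  move/IE : Iu => Iu; move: (us) (ut) => /unit_itvP us1 /unit_itvP ut1.
  have uu : unit_itv u by apply/unit_itvP; lra.
  exists ((s + u) / 2); split.
  - by apply/unit_itvP; lra.
  - by move=> e; apply: us'; lra.
  - by move=> v /IE h1; apply/IE; lra.
  - move=> [v /IE Iv hv]; have vu : v = u.
      by apply: hinj => //; [apply/unit_itvP; lra|rewrite hv].
    by apply: us'; lra.
have Iu : I s r `<=` unit_itv (R := R).
  move: us ut => /unit_itvP us1 /unit_itvP ut1.
  by move=> v /Irt /IE h1; apply/unit_itvP; lra.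
have hcI : {within I s r, continuous h} by exact: continuous_subspaceW hc.
have Is : I s r s by apply/IE; have := le_total s r; case/orP; lra.
have Ir' : I s r r by apply/IE; have := le_total s r; case/orP; lra.
have hC : continuum_set (h @` I s r).
  split; first by exists (h s), s.
    by apply: continuous_compact => //; exact: segment_compact.
  by apply: connected_continuous_connected => //; exact: segment_connected.
have hS : h @` I s r `<=` h @` I s t by apply: image_subset.
have Cs : (h @` I s r) (h s) by exists s.
have Cr : (h @` I s r) (h r) by exists r.
have hrs : h r <> h s by move=> e; apply: rs; exact: hinj.
have [_ _ cC] := hC.
have [rs0|/ltW sr0] := leP (co (h r) j0) (co (h s) j0).
  left; have [c c01 rE] := collinear_le (connected_collinear cC Ir Cr Cs) rs0.
  exists c.
    have : c <> 1 by move=> c1; apply: hrs; rewrite rE c1 scale1.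
    by move/eqP; rewrite lt_neqAle => ->; lra.
  apply: subset_trans hS; apply: (continuum_piece hC Cs); last by lra.
  by rewrite -rE.
right; have [c c01 sE] := collinear_le (connected_collinear cC Ir Cs Cr) sr0.
exists (h r), c; split => //.
apply: subset_trans hS; apply: (continuum_piece hC Cr); last by lra.
by rewrite -sE.
Qed.

Lemma arc_leaves_start A x a : is_arc A x a -> x <> o ->
  descends A x \/ ascends A x.
Proof.
move=> [h [g [[hc gc hA gh] [hx ha]]]] xo.
have := @arc_leaves h 0 1 hc; rewrite -hA hx.
have -> : Num.min 0 1 = 0 :> R by rewrite min_l.
have -> : Num.max 0 1 = 1 :> R by rewrite max_r.
apply=> //.
- by move=> u v uu uv /(congr1 g); rewrite !gh.
- by apply/unit_itvP; lra.
- by apply/unit_itvP; lra.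
- by move/eqP; rewrite eq_sym oner_eq0.
Qed.

(** Off the top there are only two directions, so two of the three arcs share a further point. *)
Lemma ramification_point_top x : ramification_point x -> x = o.
Proof.
move=> [A [B [C [a [b [c [[hA hB hC] [AB BC AC]]]]]]]]; apply: contrapT => xo.
have only P Q p : P `&` Q = [set x] -> P p -> Q p -> p = x.
  by move=> PQ Pp Qp; have : (P `&` Q) p by []; rewrite PQ.
have dd P Q : P `&` Q = [set x] -> descends P x -> descends Q x -> False.
  move=> PQ dP dQ; have [p [px Pp Qp]] := descends_meet xo dP dQ.
  exact/px/(only P Q).
have aa P Q : P `&` Q = [set x] -> ascends P x -> ascends Q x -> False.
  move=> PQ dP dQ; have [p [px Pp Qp]] := ascends_meet xo dP dQ.
  exact/px/(only P Q).
case: (arc_leaves_start hA xo) => A'; case: (arc_leaves_start hB xo) => B';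
  case: (arc_leaves_start hC xo) => C';
  by first [exact: dd AB A' B'|exact: dd BC B' C'|exact: dd AC A' C'
           |exact: aa AB A' B'|exact: aa BC B' C'|exact: aa AC A' C'].
Qed.

(** No coordinate exceeds 1, so no arc can ascend from [x]. At an interior parameter both halves of
    an arc would descend and share a point other than [x], against injectivity. *)
Lemma endpoint_of_full x j : co x j = 1 -> endpoint x.
Proof.
move=> xj A a b [h [g [[hc gc hA gh] [<- <-]]]]; rewrite -hA => -[t ut htx].
have hinj u v : unit_itv u -> unit_itv v -> h u = h v -> u = v.
  by move=> uu uv /(congr1 g); rewrite !gh.
have xo : x <> o by move=> xo; move: xj; rewrite xo co_o; lra.
have nasc C : ~ ascends C x.
  move=> [y [c [yx c01 xE _]]]; apply: yx; rewrite xE.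
  have yj := co_unit y j.
  have : c * co y j = 1 by rewrite -xj xE co_scale clamp_id.
  move=> cy; have -> : c = 1 by nra.
  by rewrite scale1.
have [t0E|/eqP t0] := eqVneq t 0; first by left; rewrite -htx t0E.
have [t1E|/eqP t1] := eqVneq t 1; first by right; rewrite -htx t1E.
have u0 : unit_itv (0 : R) by apply/unit_itvP; lra.
have u1 : unit_itv (1 : R) by apply/unit_itvP; lra.
have hto : h t <> o by rewrite htx.
have := arc_leaves hc hinj ut u0 t0 hto; rewrite htx => -[d1|/nasc //].
have := arc_leaves hc hinj ut u1 t1 hto; rewrite htx => -[d2|/nasc //].
have [p [px [u Iu hu] [v Iv hv]]] := descends_meet xo d1 d2.
exfalso; move/unit_itvP : ut => ut1.
have [t0' t1'] : 0 <= t /\ t <= 1 by lra.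
move: Iu Iv; rewrite /= !in_itv /= (min_r t0') (max_l t0') (min_l t1') (max_r t1').
move=> Iu Iv; have uv : u = v.
  by apply: hinj; rewrite ?unit_itvP ?hu ?hv //; lra.
by apply: px; rewrite -htx -hu; congr h; lra.
Qed.

(** * Arcs along rays and through the top *)

Lemma scale_inj x s t : x <> o -> 0 <= s <= 1 -> 0 <= t <= 1 ->
  scale s x = scale t x -> s = t.
Proof.
move=> /co_j0_gt0 x0 s01 t01 /(congr1 (co ^~ j0)); rewrite /= !co_scale !clamp_id //.
by apply: mulIf; rewrite gt_eqF.
Qed.

Lemma ray_arc x s t : x <> o -> s <> t -> 0 <= s <= 1 -> 0 <= t <= 1 ->
  exists A, is_arc A (scale s x) (scale t x).
Proof.
move=> xo st s01 t01; pose h u := scale (s + u * (t - s)) x.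
exists (h @` unit_itv (R := R)).
have -> : scale s x = h 0 by rewrite /h mul0r addr0.
have -> : scale t x = h 1 by rewrite /h mul1r addrC subrK.
apply: is_arc_of_injective.
  apply/continuous_subspaceT/(@lipschitz_real_continuous _ _ 1) => u v.
  apply: le_trans (scale_lip _ _ _) _; rewrite !mul1r.
  have -> : s + u * (t - s) - (s + v * (t - s)) = (t - s) * (u - v) by ring.
  by rewrite normrM ler_piMl // ler_norml; lra.
move=> u v /unit_itvP u01 /unit_itvP v01 /scale_inj h1.
have : s + u * (t - s) = s + v * (t - s) by apply: h1 => //; nra.
move/addrI/mulIf; apply; rewrite subr_eq0; apply/eqP => ts; exact: st.
Qed.

(** The arc runs down the ray of [a] to the top and then up the ray of [b]. *)
Lemma bridge_arc a b : ~ collinear a b -> exists A, is_arc A a b.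
Proof.
move=> nab.
have ao : a <> o by move=> ao; apply: nab => j; rewrite ao !co_o; ring.
have bo : b <> o by move=> bo; apply: nab => j; rewrite bo !co_o; ring.
pose h t := if t <= 2^-1 then scale (1 - 2 * t) a else scale (2 * t - 1) b.
(* Each clamp vanishes on the other half, so a single formula gives the Lipschitz bound without
   gluing. *)
have hE t j : co (h t) j =
    clamp (1 - 2 * t) * co a j + clamp (2 * t - 1) * co b j.
  rewrite /h; case: leP => t2; rewrite co_scale.
    by rewrite (@clamp_le0 _ (2 * t - 1)) ?mul0r ?addr0 //; lra.
  by rewrite (@clamp_le0 _ (1 - 2 * t)) ?mul0r ?add0r //; lra.
exists (h @` unit_itv (R := R)).
have -> : a = h 0.
  by rewrite /h ifT ?mulr0 ?subr0 ?scale1 // invr_ge0.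
have -> : b = h 1.
  by rewrite /h ifF ?mulr1; [rewrite -{1}(scale1 b); congr scale; ring|lra].
apply: is_arc_of_injective.
  apply/continuous_subspaceT/(@lipschitz_real_continuous _ _ 4) => s t.
  apply: mdist_le_coord => j; rewrite !hE.
  have h1 := clamp_lip (1 - 2 * s) (1 - 2 * t).
  have h2 := clamp_lip (2 * s - 1) (2 * t - 1).
  have e1 : `|1 - 2 * s - (1 - 2 * t)| = 2 * `|s - t|.
    have -> : 1 - 2 * s - (1 - 2 * t) = (- 2) * (s - t) by ring.
    by rewrite normrM normrN (@ger0_norm _ 2).
  have e2 : `|2 * s - 1 - (2 * t - 1)| = 2 * `|s - t|.
    have -> : 2 * s - 1 - (2 * t - 1) = 2 * (s - t) by ring.
    by rewrite normrM (@ger0_norm _ 2).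
  have -> : clamp (1 - 2 * s) * co a j + clamp (2 * s - 1) * co b j -
    (clamp (1 - 2 * t) * co a j + clamp (2 * t - 1) * co b j) =
    (clamp (1 - 2 * s) - clamp (1 - 2 * t)) * co a j +
    (clamp (2 * s - 1) - clamp (2 * t - 1)) * co b j by ring.
  apply: le_trans (ler_normD _ _) _; rewrite !normrM.
  rewrite (ger0_norm (co_ge0 a j)) (ger0_norm (co_ge0 b j)).
  have := co_unit a j; have := co_unit b j.
  have := normr_ge0 (clamp (1 - 2 * s) - clamp (1 - 2 * t)).
  have := normr_ge0 (clamp (2 * s - 1) - clamp (2 * t - 1)).
  rewrite e1 in h1; rewrite e2 in h2; move: h1 h2.
  set p := `|clamp (1 - 2 * s) - _|; set q := `|clamp (2 * s - 1) - _|.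
  by nra.
(* A point common to both halves would be off the top and make [a] and [b] collinear. *)
have mixed s t : 0 <= s <= 2^-1 -> 2^-1 < t <= 1 ->
    scale (1 - 2 * s) a = scale (2 * t - 1) b -> False.
  move=> s01 t01 e; apply: nab.
  apply: (@collinear_trans _ (scale (2 * t - 1) b)).
  - rewrite -(scale0 b) => /(scale_inj bo) e'.
    suff : 2 * t - 1 = 0 by lra.
    by apply: e'; lra.
  - by rewrite -e; exact: collinear_scale.
  - exact/collinear_sym/collinear_scale.
move=> s t /unit_itvP s01 /unit_itvP t01; rewrite /h.
case: (leP s 2^-1) => s2; case: (leP t 2^-1) => t2.
- move=> /(scale_inj ao) e; have : 1 - 2 * s = 1 - 2 * t by apply: e; lra.
  by lra.
- by move/mixed; case; lra.
- by move/esym/mixed; case; lra.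
- move=> /(scale_inj bo) e; have : 2 * s - 1 = 2 * t - 1 by apply: e; lra.
  by lra.
Qed.

Lemma fan_arcwise_connected : @arcwise_connected R X.
Proof.
move=> a b ab; have [cab|] := pselect (collinear a b); last exact: bridge_arc.
have [/(collinear_le cab) [c c01 aE]|/ltW] := leP (co a j0) (co b j0).
  have bo : b <> o by move=> bo; apply: ab; rewrite aE bo scaleo.
  rewrite aE -{2}(scale1 b); apply: ray_arc => //; last by lra.
  by move=> c1; apply: ab; rewrite aE c1 scale1.
move=> /(collinear_le (collinear_sym cab)) [c c01 bE].
have ao : a <> o by move=> ao; apply: ab; rewrite bE ao scaleo.
rewrite bE -{1}(scale1 a); apply: ray_arc => //; last by lra.
by move=> c1; apply: ab; rewrite bE -c1 scale1.
Qed.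

(** * Arcs from the top, smoothness and the Lelek fan criterion *)

Lemma ray_arc_top x : x <> o -> is_arc (piece x 0 1) o x.
Proof.
move=> xo; rewrite -{1}(scale0 x) -{3}(scale1 x).
apply: (@is_arc_of_injective _ _ (scale ^~ x)).
  exact/continuous_subspaceT/scale_continuous.
by move=> s t /unit_itvP s01 /unit_itvP t01; exact: scale_inj.
Qed.

(** The arc is a continuum containing both ends of the segment, hence the whole segment; being
    irreducible between its ends, it is no larger. *)
Lemma arc_from_topE A x : arc_or_point A o x -> A = piece x 0 1.
Proof.
move=> [[<- ->]|hA].
  rewrite eqEsubset; split => [_ ->|_ [t _ <-]]; last by rewrite scaleo.
  by exists 0; rewrite ?scaleo //= in_itv /=; lra.
have [cA Ao Ax] := is_arc_continuum hA.
have pA : piece x 0 1 `<=` A by apply: (continuum_piece cA Ax); rewrite ?scale0.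
have [p0 p1] := @piece_end x 0 1 ler01.
rewrite scale0 in p0; rewrite scale1 in p1.
apply/seteqP; split => //.
exact: (is_arc_irreducible hA (@piece_connected x 0 1) pA).
Qed.

(** Scaling by a fixed factor does not increase distances, so matching equal factors bounds the
    Hausdorff distance of two segments by the distance of their upper ends. *)
Lemma fan_smooth : smooth_at o.
Proof.
move=> u x ux A_ A hA_ hA; have -> := arc_from_topE hA.
apply/cvgrPdist_lt => e e0.
have e2 : 0 < e / 2 by lra.
have /cvg_ballP /(_ _ e2) := ux; apply: filterS => n.
rewrite (arc_from_topE (hA_ n)) ballEmdist /= => uxn.
have He : [set e : R | [/\ 0 < e,
    forall a, piece (u n) 0 1 a -> exists2 b, piece x 0 1 b & mdist a b < e &
    forall b, piece x 0 1 b -> exists2 a, piece (u n) 0 1 a & mdist a b < e]]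
    (e / 2).
  split => //.
    move=> _ [c c01 <-]; exists (scale c x); first by exists c.
    by rewrite metric_sym (le_lt_trans (scale_dist _ _ _)).
  move=> _ [c c01 <-]; exists (scale c (u n)); first by exists c.
  by rewrite metric_sym (le_lt_trans (scale_dist _ _ _)).
have H0 : 0 <= hausdorff_dist (piece (u n) 0 1) (piece x 0 1).
  apply: lb_le_inf; first by exists (e / 2).
  by move=> d [/ltW].
rewrite sub0r normrN ger0_norm //; apply: (@le_lt_trans _ _ (e / 2)); last by lra.
apply: ge_inf He; exists 0.
by move=> d [/ltW].
Qed.

Lemma top_ramification_point (a b c : X) : ~ collinear a b -> ~ collinear b c ->
  ~ collinear a c -> ramification_point o.
Proof.
have no x y : ~ collinear x y -> x <> o /\ y <> o.
  by move=> xy; split => e; apply: xy => j; rewrite e !co_o; ring.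
have meet x y : ~ collinear x y -> piece x 0 1 `&` piece y 0 1 = [set o].
  move=> xy; rewrite eqEsubset; split => [_ [[s s01 <-] [t t01 e]]|_ ->].
    apply: contrapT => so; apply: xy; apply: (collinear_trans so).
      exact: collinear_scale.
    by rewrite -e; exact/collinear_sym/collinear_scale.
  have top z : piece z 0 1 o by have := (@piece_end z 0 1 ler01).1; rewrite scale0.
  by split; exact: top.
move=> ab bc ac; have [ao bo] := no _ _ ab; have [_ co'] := no _ _ bc.
exists (piece a 0 1), (piece b 0 1), (piece c 0 1), a, b, c.
by split; split; [exact: ray_arc_top..|exact: meet|exact: meet|exact: meet].
Qed.

Theorem Lelek_fan_coordinates (a b c : X) :
  ~ collinear a b -> ~ collinear b c -> ~ collinear a c ->
  dense [set x : X | exists j, co x j = 1] -> Lelek_fan X.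
Proof.
move=> ab bc ac fd; exists o; split; [split|exact: fan_smooth|].
- exact: fan_continuum.
- exact: fan_arcwise_connected.
- exact: fan_hereditarily_unicoherent.
- move=> x; split => [/ramification_point_top //|->].
  exact: (top_ramification_point ab bc ac).
- move=> O O0 oO; have [x [Ox [j xj]]] := fd O O0 oO.
  by exists x; split => //; exact: endpoint_of_full xj.
Qed.

End Fan.

(** * Powers of 2 and 3 *)

Section PowersTwoThree.
Context {R : realType}.
Implicit Types (m h g e : R).

(** Bernoulli's inequality and the Archimedean property. *)
Lemma exists_expn_gt m h : 1 < m -> exists n, h < m ^+ n.
Proof.
move=> m1; have bern n : 1 + (m - 1) *+ n <= m ^+ n.
  elim: n => [|n IH]; first by rewrite mulr0n addr0 expr0.
  have n0 : 0 <= (m - 1) *+ n by rewrite mulrn_wge0 //; lra.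
  by rewrite exprS mulrSr; nra.
have d0 : 0 < m - 1 by lra.
have [n hn] : exists n, `|h| / (m - 1) < n%:R.
  by exists (Num.bound (`|h| / (m - 1))); apply: archi_boundP; rewrite divr_ge0 // ltW.
exists n; apply: lt_le_trans (bern n).
move: hn; rewrite ltr_pdivrMr // => hn.
have := ler_norm h; rewrite -mulr_natl; lra.
Qed.

Lemma expn_floor m h : 1 < m -> 1 <= h -> exists k, m ^+ k <= h < m ^+ k.+1.
Proof.
move=> m1 h1; have ex := exists_expn_gt h m1.
have [[|k] kP kmin] := ex_minnP ex; first by move: kP; rewrite expr0; lra.
exists k; rewrite kP andbT leNgt; apply/negP => /kmin; lia.
Qed.

(** The multiplicative group generated by 2 and 3, with natural exponents on both sides in place of
    integer ones. *)
Definition pow23 g := exists a b c d, g * 2 ^+ a * 3 ^+ b = 2 ^+ c * 3 ^+ d.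

Lemma pow23_gt0 g : pow23 g -> 0 < g.
Proof.
move=> [a [b [c [d gE]]]].
have p23 i j : (0 : R) < 2 ^+ i * 3 ^+ j by rewrite mulr_gt0 // exprn_gt0.
have := p23 c d; rewrite -gE -mulrA pmulr_lgt0 //.
Qed.

Lemma pow23_div g h : pow23 g -> pow23 h -> pow23 (g / h).
Proof.
move=> /[dup] /pow23_gt0 g0 [a [b [c [d gE]]]]
  /[dup] /pow23_gt0 h0 [a' [b' [c' [d' hE]]]].
exists (a + c')%N, (b + d')%N, (c + a')%N, (d + b')%N.
apply: (@mulIf _ h); first by rewrite gt_eqF.
rewrite !exprD.
have -> : g / h * (2 ^+ a * 2 ^+ c') * (3 ^+ b * 3 ^+ d') * h =
  (g * 2 ^+ a * 3 ^+ b) * (2 ^+ c' * 3 ^+ d') by field; rewrite gt_eqF.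
by rewrite gE -hE; ring.
Qed.

Lemma pow23_1 : pow23 1.
Proof. by exists 0%N, 0%N, 0%N, 0%N; rewrite !expr0 !mulr1. Qed.

Lemma pow23_2 : pow23 2.
Proof. by exists 0%N, 0%N, 1%N, 0%N; rewrite !expr0 expr1 !mulr1. Qed.

Lemma pow23_3 : pow23 3.
Proof. by exists 0%N, 0%N, 0%N, 1%N; rewrite !expr0 expr1 !mulr1 mul1r. Qed.

Lemma pow23_X g k : pow23 g -> pow23 (g ^+ k).
Proof.
move=> hg; elim: k => [|k IH]; first exact: pow23_1.
have -> : g ^+ k.+1 = g ^+ k / (1 / g) by rewrite exprSr div1r invrK.
by apply: pow23_div => //; apply: pow23_div => //; exact: pow23_1.
Qed.

(** The left side is even and the right side odd. *)
Lemma pow2_neq_pow3 p q : (0 < p)%N -> (2 : R) ^+ p <> 3 ^+ q.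
Proof.
move=> p0 /eqP; rewrite -!natrX eqr_nat => /eqP /(congr1 odd).
by rewrite !oddX /= orbF orbT; case: p p0.
Qed.

(* Otherwise the elements above 1 have a least one, m, of which 2 and 3 are both
   powers, against unique factorization. *)
Lemma pow23_dense e : 0 < e -> exists2 g, pow23 g & 1 < g < 1 + e.
Proof.
move=> e0; apply: contrapT => nog.
pose S := [set g | pow23 g /\ 1 < g].
have Sge g : S g -> 1 + e <= g.
  by move=> [pg g1]; rewrite leNgt; apply/negP => ge; apply: nog; exists g => //; lra.
have S2 : S 2 by split; [exact: pow23_2|lra].
have Sinf : has_inf S by split; [exists 2|exists (1 + e)].
have m1 : 1 < inf S.
  by apply: (@lt_le_trans _ _ (1 + e)); [lra|apply: lb_le_inf => //; exists 2].
have Sm g : S g -> inf S <= g by move=> Sg; apply: ge_inf => //; case: Sinf.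
set m := inf S in m1 Sm *.
have [g Sg gm] : exists2 g, S g & g < m * m.
  have mm : 0 < m * m - m by nra.
  have [g Sg gm] := inf_adherent mm Sinf.
  by exists g => //; move: gm; rewrite -/m; lra.
(* If [g] exceeded [m], an element [g'] of [S] below [g] would give [g / g'] in [S], below [m]
   because [g < m * m]. *)
have gE : g = m.
  apply/eqP; rewrite eq_le Sm // andbT leNgt; apply/negP => mg.
  have gm0 : 0 < g - m by lra.
  have [g' Sg' g'm] := inf_adherent gm0 Sinf; rewrite -/m in g'm.
  have mg' := Sm _ Sg'; have g'0 : 0 < g' by lra.
  have Sgg : S (g / g').
    split; first by apply: pow23_div; [case: Sg|case: Sg'].
    by rewrite ltr_pdivlMr // mul1r; lra.
  have := Sm _ Sgg; rewrite ler_pdivlMr // => h.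
  have : m * m <= m * g' by rewrite ler_pM2l //; lra.
  lra.
have pm : pow23 m by rewrite -gE; case: Sg.
(* Dividing [h] by the largest power of [m] below it leaves a quotient in [1, m), which is 1 by
   minimality. *)
have powm h : pow23 h -> 1 < h -> exists k, h = m ^+ k.
  move=> ph h1; have [k /andP[kh hk]] := expn_floor m1 (ltW h1).
  have mk : 0 < m ^+ k by rewrite exprn_gt0 //; lra.
  exists k; apply/eqP; rewrite eq_le kh andbT leNgt; apply/negP => mh.
  have Sh : S (h / m ^+ k).
    split; first by apply: pow23_div => //; exact: pow23_X.
    by rewrite ltr_pdivlMr // mul1r.
  have := Sm _ Sh; rewrite ler_pdivlMr // -exprS; lra.
have [p p2] := powm 2 pow23_2 ltac:(lra).
have [q q3] := powm 3 pow23_3 ltac:(lra).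
have p0 : (0 < q)%N.
  by case: q q3 => // /eqP; rewrite expr0 -[1]/(1%:R) eqr_nat.
apply: (pow2_neq_pow3 (q := p) p0).
by rewrite p2 q3 -!exprM mulnC.
Qed.

End PowersTwoThree.

(* The triangular wave of period 2 M that is the identity on [0, M]. *)
Definition wave (M : nat) (k : int) : nat :=
  `|(((k + M%:Z) %% (2 * M)%N%:Z)%Z - M%:Z)%R|%N.

Lemma wave_period M k : wave M (k + (2 * M)%N%:Z) = wave M k.
Proof.
rewrite /wave; have -> : k + (2 * M)%N%:Z + M%:Z = k + M%:Z + (2 * M)%N%:Z by lia.
by rewrite modzDr.
Qed.

Lemma wave_id M k : (0 < M)%N -> 0 <= k -> k <= M%:Z -> wave M k = `|k|%N.
Proof.
move=> M0 k0; rewrite le_eqVlt => /orP[/eqP ->|kM].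
  have -> : wave M M = wave M ((- M%:Z) + (2 * M)%N%:Z) by congr wave; lia.
  by rewrite wave_period /wave addNr mod0z sub0r; lia.
by rewrite /wave modz_small ?addrK //; lia.
Qed.

Lemma wave_step M k : (0 < M)%N ->
  wave M (k + 1) = (wave M k).+1 \/ wave M k = (wave M (k + 1)).+1.
Proof.
move=> M0; rewrite /wave.
have -> : ((k + 1 + M%:Z) %% (2 * M)%N%:Z)%Z =
    ((((k + M%:Z) %% (2 * M)%N%:Z)%Z + 1) %% (2 * M)%N%:Z)%Z.
  by rewrite modzDml; congr (_ %% _)%Z; lia.
have r0 : 0 <= ((k + M%:Z) %% (2 * M)%N%:Z)%Z by apply: modz_ge0; lia.
have r1 : ((k + M%:Z) %% (2 * M)%N%:Z)%Z < (2 * M)%N%:Z by apply: ltz_pmod; lia.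
move: ((k + M%:Z) %% (2 * M)%N%:Z)%Z r0 r1 => r r0 r1.
have [rM|rM] := eqVneq (r + 1) (2 * M)%N%:Z; first by rewrite rM modzz; lia.
by rewrite modz_small; lia.
Qed.


(** * Index arithmetic for symmetric windows *)

Lemma window_absK (i : int) (N : nat) : (`|i| <= N)%N ->
  `|(i + N%:Z)%R|%N%:Z - N%:Z = i.
Proof. lia. Qed.

Lemma window_abs_le (i : int) (N : nat) : (`|i| <= N)%N -> (`|(i + N%:Z)%R| <= 2 * N)%N.
Proof. lia. Qed.

Lemma window_absD (i : int) (n N : nat) : (`|i| <= N)%N ->
  `|(i + n%:Z + N%:Z)%R|%N = (n + `|(i + N%:Z)%R|)%N.
Proof. lia. Qed.

Lemma double_subz (N : nat) : (2 * N)%N%:Z - N%:Z = N%:Z :> int.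
Proof. lia. Qed.

Lemma double_add (N n : nat) : (N + n + N)%N = (2 * N + n)%N.
Proof. lia. Qed.

(** * Factor maps *)

Section Factor.
Context {R : realType} {X Y : metricType R} (f : X -> X) (g : Y -> Y) (pi : X -> Y).
Hypothesis pi_shift : forall x, pi (f x) = g (pi x).
Hypothesis pi_surjective : forall y, exists x, pi x = y.
Hypothesis pi_dist : forall x y, mdist (pi x) (pi y) <= mdist x y.

Lemma factor_continuous : continuous pi.
Proof. by apply: (@lipschitz_continuous _ _ _ 1) => x y; rewrite mul1r. Qed.

Lemma factor_iter n x : pi (iter n f x) = iter n g (pi x).
Proof. by elim: n => //= n <-. Qed.

Lemma factor_open U : open U -> U !=set0 -> open (pi @^-1` U) /\ (pi @^-1` U) !=set0.
Proof.
move=> oU [y Uy]; split.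
  by apply: open_comp oU => x _; exact: factor_continuous.
by have [x xy] := pi_surjective y; exists x; rewrite /= xy.
Qed.

Lemma factor_dense (A : set X) (B : set Y) : (forall x, A x -> B (pi x)) ->
  dense A -> dense B.
Proof.
move=> AB dA O O0 oO; have [oO' O0'] := factor_open oO O0.
by have [x [Ox Ax]] := dA _ O0' oO'; exists (pi x); split => //; exact: AB.
Qed.

Lemma factor_transitive : transitive_map f -> transitive_map g.
Proof.
move=> tf U V oU oV U0 V0.
have [oU' U0'] := factor_open oU U0; have [oV' V0'] := factor_open oV V0.
have [n [_ [[x Ux <-] Vx]]] := tf _ _ oU' oV' U0' V0'.
by exists n, (pi (iter n f x)); split => //; exists (pi x); rewrite ?factor_iter.
Qed.

Lemma factor_periodic_dense :
  dense [set x | periodic_point f x] -> dense [set y | periodic_point g y].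
Proof.
apply: factor_dense => x [n n0 fx].
by exists n => //; rewrite -factor_iter fx.
Qed.

Lemma factor_specification : specification f -> specification g.
Proof.
move=> sf e e0; have [N N0 sN] := sf e e0; exists N => // n y k l n1 kl kN.
have [x xy] := choice (fun i => pi_surjective (y i)).
have [z zP] := sN n x k l n1 kl kN.
exists (pi z) => i j ij kj; rewrite -xy -!factor_iter.
exact: le_trans (pi_dist _ _) (zP i j ij kj).
Qed.

End Factor.

Lemma surjective_iter (T : Type) (f : T -> T) n :
  (forall y, exists x, f x = y) -> forall y, exists x, iter n f x = y.
Proof.
move=> fs; elim: n => [|n IH] y; first by exists y.
by have [x <-] := fs y; have [z <-] := IH x; exists z.
Qed.

(** Specification is applied to two one-point blocks: time 0 of [x], and time [n] of an n-th
    preimage of [y]. *)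
Lemma specification_mixing (R : realType) (X : metricType R) (f : X -> X) :
  (forall y, exists x, f x = y) -> specification f -> topologically_mixing f.
Proof.
move=> fs sf U V oU oV [x Ux] [y Vy].
have /nbhs_ballP [a /= a0 aU] : nbhs x U by exact: open_nbhs_nbhs.
have /nbhs_ballP [b /= b0 bV] : nbhs y V by exact: open_nbhs_nbhs.
move: aU bV; rewrite !ballEmdist => aU bV.
have [e [e0 ea eb]] : exists e : R, [/\ 0 < e, e < a & e < b].
  exists (Num.min a b / 2).
  have a0' : 0 < a by []. have b0' : 0 < b by [].
  by rewrite /Num.min; case: ifP; split; lra.
have [N N0 sN] := sf e e0; exists N => n Nn.
have [y' y'y] := surjective_iter n fs y.
have [||z zP] := sN 2%N (fun i => if i == 1%N then x else y')
    (fun i => if i == 1%N then 0%N else n) (fun i => if i == 1%N then 0%N else n) isT.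
- by move=> j _.
- by move=> [|[|j]] //; rewrite add0n.
exists (iter n f z); split.
  exists z => //; apply: aU => /=; rewrite metric_sym.
  by apply: le_lt_trans ea; exact: (zP 1%N 0%N).
apply: bV; rewrite /= metric_sym -y'y.
by apply: le_lt_trans eb; apply: (zP 2%N n); rewrite //= leqnn.
Qed.

(** * Mahavier products of lines *)

Section Lines.
Context {R : realType} (Om : set R).
Hypothesis Om_finite : finite_set Om.
Hypothesis Om_gt0 : forall a, Om a -> 0 < a.
Hypothesis Om_inv : forall a, Om a -> Om a^-1.

Local Notation F := (lines_rel Om).
Implicit Types (p q r : nat -> R) (c u v : R).

Lemma lines_relP u v :
  F (u, v) <-> [/\ 0 <= u <= 1, 0 <= v <= 1 & exists2 a, Om a & v = a * u].
Proof. by split => -[/unit_itvP u1 /unit_itvP v1 h]. Qed.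

Lemma lines_rel_sym u v : F (u, v) -> F (v, u).
Proof.
move=> /lines_relP [u1 v1 [a Oa va]]; apply/lines_relP; split => //.
exists a^-1; first exact: Om_inv.
by rewrite va mulKf // gt_eqF // Om_gt0.
Qed.

Lemma lines_rel_scale c u v : 0 <= c <= 1 -> F (u, v) -> F (c * u, c * v).
Proof.
move=> c1 /lines_relP [u1 v1 [a Oa va]]; apply/lines_relP; split => //.
- by nra.
- by nra.
- by exists a => //; rewrite va mulrCA.
Qed.

Lemma lines_rel_closed : closed (F : set (R * R)).
Proof.
have -> : F = [set z : R * R | unit_itv z.1] `&` [set z : R * R | unit_itv z.2] `&`
    \bigcup_(a in Om) [set z : R * R | z.2 - a * z.1 = 0].
  rewrite eqEsubset; split => [z [z1 z2 [a Oa za]]|z [[z1 z2] [a Oa /subr0_eq za]]].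
    by split => //; exists a => //=; rewrite za subrr.
  by split => //; exists a.
apply: closedI; first apply: closedI.
- apply: (@preimage_closed _ _ fst (unit_itv (R := R))) => [z _|].
    exact: cvg_fst.
  exact: itv_closed.
- apply: (@preimage_closed _ _ snd (unit_itv (R := R))) => [z _|].
    exact: cvg_snd.
  exact: itv_closed.
- apply: closed_bigcup => // a _.
  apply: (@preimage_closed _ _ (fun z : R * R => z.2 - a * z.1) [set x : R | x = 0]).
    move=> z _; apply: cvgB; first exact: cvg_snd.
    by apply: cvgM; [exact: cvg_cst|exact: cvg_fst].
  exact: closed_eq.
Qed.

(** * Chains and their two-sided extensions *)

Definition chain p := forall i, F (p i, p i.+1).

Lemma chain_itv p i : chain p -> 0 <= p i <= 1.
Proof. by move=> /(_ i) /lines_relP []. Qed.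

Definition plus_of_chain p (hp : chain p) : mahavier_plus F :=
  @MahavierPlus R F p (fun i => iffRL (unit_itvP _) (chain_itv i hp)) hp.

Lemma reflect_rel p (hp : chain p) (N : nat) (i : int) :
  F (p `|(i + N%:Z)%R|%N, p `|(i + 1 + N%:Z)%R|%N).
Proof.
rewrite addrAC; move: (i + N%:Z) => k; have [k0|k0] := leP 0 k.
  by have -> : `|(k + 1)%R|%N = `|k|%N.+1 by lia.
have -> : `|k|%N = `|(k + 1)%R|%N.+1 by lia.
exact: lines_rel_sym.
Qed.

(* Invertibility of the slopes lets a chain be continued to the left by its
   mirror image. *)
Definition mah_of_chain p (hp : chain p) (N : nat) : mahavier F :=
  @Mahavier R F (fun i => p `|(i + N%:Z)%R|%N)
    (fun i => iffRL (unit_itvP _) (chain_itv _ hp)) (reflect_rel hp N).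

Lemma mplus_chain (x : mahavier_plus F) : chain x.
Proof. by move=> i; exact: mplus_rel. Qed.

Lemma mah_chain (x : mahavier F) (N : nat) : chain (fun i : nat => x (i%:Z - N%:Z)).
Proof.
move=> i; have := mah_rel x (i%:Z - N%:Z).
by have -> : i%:Z - N%:Z + 1 = i.+1%:Z - N%:Z by lia.
Qed.

Lemma mah_unit (x : mahavier F) i : 0 <= x i <= 1.
Proof. exact/unit_itvP/mah_itv. Qed.

Lemma mplus_unit (x : mahavier_plus F) i : 0 <= x i <= 1.
Proof. exact/unit_itvP/mplus_itv. Qed.

Lemma chain_scale p c : chain p -> chain (fun i => clamp c * p i).
Proof. by move=> hp i; apply: lines_rel_scale => //; exact: clamp_itv. Qed.

Definition mplus_scale c (x : mahavier_plus F) : mahavier_plus F :=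
  plus_of_chain (chain_scale c (mplus_chain x)).

Lemma mah_scale_rel c (x : mahavier F) i : F (clamp c * x i, clamp c * x (i + 1)).
Proof. by apply: lines_rel_scale; [exact: clamp_itv|exact: mah_rel]. Qed.

Lemma mah_scale_itv c (x : mahavier F) i : unit_itv (clamp c * x i).
Proof. by case: (mah_scale_rel c x i). Qed.

Definition mah_scale c (x : mahavier F) : mahavier F :=
  @Mahavier R F (fun i => clamp c * x i) (mah_scale_itv c x) (mah_scale_rel c x).

(** The factor map from the two-sided to the one-sided system; the transport identifies [i%:Z + 1]
    with [i.+1%:Z]. *)
Definition restrict (x : mahavier F) : mahavier_plus F :=
  @MahavierPlus R F (fun i => x i%:Z) (fun i => mah_itv x i%:Z)
    (fun i => eq_ind _ (fun k => F (x i%:Z, x k)) (mah_rel x i%:Z) _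
       (etrans (addrC i%:Z 1) (esym (intS i)))).

Fixpoint slope_products (n : nat) : set R :=
  if n is m.+1 then [set a * b | a in Om & b in slope_products m] else [set 1].

Lemma slope_products_finite n : finite_set (slope_products n).
Proof. by elim: n => [|n IH] /=; [exact: finite_set1|exact: finite_image2]. Qed.

Lemma chain_ratio p n : chain p -> exists2 d, slope_products n d & p n = d * p 0%N.
Proof.
move=> hp; elim: n => [|n [d nd pn]]; first by exists 1; rewrite ?mul1r.
have /lines_relP [_ _ [a Oa pa]] := hp n.
by exists (a * d); [exists a => //; exists d|rewrite pa pn mulrA].
Qed.

(** At negative indices the sequence is read backwards, which is again a chain because slopes are
    closed under inverses. *)
Lemma mah_ratio (x : mahavier F) i :
  exists2 d, slope_products `|i|%N d & x i = d * x 0.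
Proof.
have [i0|i0] := leP 0 i.
  have [d nd xd] := chain_ratio `|i|%N (mah_chain x 0).
  exists d => //; move: xd; rewrite !subr0 => <-; congr (x _); lia.
have hp : chain (fun k : nat => x (- k%:Z)).
  move=> k; apply: lines_rel_sym; have := mah_rel x (- k.+1%:Z).
  by have -> : - k.+1%:Z + 1 = - k%:Z by lia.
have [d nd xd] := chain_ratio `|i|%N hp.
exists d => //; move: xd; rewrite oppr0 => <-; congr (x _); lia.
Qed.

(** * Closedness of the products and finiteness of windows *)

Lemma mplus_complete (G : set_system (mahavier_plus F)) : ProperFilter G ->
  forall l : nat -> R, (forall j, (fun x : mahavier_plus F => x j) @ G --> l j) ->
  exists x : mahavier_plus F, x = l :> (nat -> R).
Proof.
move=> PG l xl.
have hl : chain l.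
  move=> i; apply: (@closed_cvg _ _ G PG (fun x : mahavier_plus F => (x i, x i.+1)) F
    lines_rel_closed).
    by apply: nearW => x; exact: mplus_rel.
  have FG : Filter G by exact: PG.
  by apply: (@cvg_pair _ _ _ G (nbhs (l i)) (nbhs (l i.+1))); exact: xl.
by exists (plus_of_chain hl).
Qed.

Lemma mah_complete (G : set_system (mahavier F)) : ProperFilter G ->
  forall l : int -> R, (forall j, (fun x : mahavier F => x j) @ G --> l j) ->
  exists x : mahavier F, x = l :> (int -> R).
Proof.
move=> PG l xl.
have hl i : F (l i, l (i + 1)).
  apply: (@closed_cvg _ _ G PG (fun x : mahavier F => (x i, x (i + 1))) F
    lines_rel_closed).
    by apply: nearW => x; exact: mah_rel.
  have FG : Filter G by exact: PG.
  by apply: (@cvg_pair _ _ _ G (nbhs (l i)) (nbhs (l (i + 1)))); exact: xl.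
by exists (@Mahavier R F l (fun i => let: And3 h _ _ := hl i in h) hl).
Qed.

Lemma int_window_finite N : finite_set [set i : int | (`|i| <= N)%N].
Proof.
apply: (@sub_finite_set _ _ ((fun n : nat => n%:Z - N%:Z) @` `I_(2 * N).+1)).
  by move=> i /= iN; exists `|(i + N%:Z)%R|%N; [rewrite /=; lia|lia].
exact/finite_image/finite_II.
Qed.

Lemma nat_window_finite N : finite_set [set i : nat | (i.+1 <= N)%N].
Proof. by apply: (@sub_finite_set _ _ `I_N) => //; exact: finite_II. Qed.

(** * Reachable values and splicing of chains *)

Fixpoint reach n u v : Prop :=
  if n is m.+1 then exists2 t, F (u, t) & reach m t v else u = v.

Lemma reach_trans m n u v t : reach m u v -> reach n v t -> reach (m + n) u t.
Proof.
elim: m u => [|m IH] u /=; first by move=> ->.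
by move=> [s us sv] vt; exists s => //; exact: IH.
Qed.

Lemma reach_sym n u v : reach n u v -> reach n v u.
Proof.
elim: n u => [|n IH] u /=; first by [].
move=> [t ut tv]; suff : reach (n + 1) v u by rewrite addn1.
apply: reach_trans (IH _ tv) _.
by exists u => //; exact: lines_rel_sym.
Qed.

Lemma reach_up a n u : Om a -> 1 <= a -> 0 <= u -> a ^+ n * u <= 1 ->
  reach n u (a ^+ n * u).
Proof.
move=> Oa a1; elim: n u => [|n IH] u u0 /=; first by rewrite expr0 mul1r.
rewrite exprSr -mulrA => h.
have au0 : u <= a * u by nra.
have an : a * u <= a ^+ n * (a * u) by rewrite ler_peMl ?exprn_ege1 //; lra.
exists (a * u); last by apply: IH => //; lra.
by apply/lines_relP; split; [lra|lra|exists a].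
Qed.

Lemma reach_down a n u : Om a -> 1 <= a -> 0 <= u <= 1 -> reach n u (u / a ^+ n).
Proof.
move=> Oa a1 u01; have an : 0 < a ^+ n by rewrite exprn_gt0 //; lra.
have uE : a ^+ n * (u / a ^+ n) = u by rewrite mulrCA divff ?mulr1 // gt_eqF.
have u0 : 0 <= u / a ^+ n by rewrite divr_ge0 //; lra.
have := @reach_up a n _ Oa a1 u0; rewrite uE => h.
by apply/reach_sym/h; lra.
Qed.

Lemma reach_gt0 n u v : reach n u v -> 0 < u -> 0 < v.
Proof.
elim: n u => [|n IH] u /=; first by move=> ->.
move=> [t /lines_relP [_ _ [a /Om_gt0 a0 ->]] tv] u0.
by apply: IH tv _; rewrite mulr_gt0.
Qed.

Lemma chain_reach p e n : chain p -> reach n (p e) (p (e + n)%N).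
Proof.
move=> hp; elim: n e => [|n IH] e /=; first by rewrite addn0.
by exists (p e.+1); [exact: hp|rewrite addnS -addSn].
Qed.

Lemma chain_gt0 p i j : chain p -> 0 < p i -> 0 < p j.
Proof.
move=> hp pi; have [ij|/ltnW ji] := leqP i j.
  by have := chain_reach i (j - i) hp; rewrite subnKC // => /reach_gt0; apply.
by have := chain_reach j (i - j) hp; rewrite subnKC // => /reach_sym/reach_gt0; apply.
Qed.

Lemma chain_prepend n u q : chain q -> reach n u (q 0%N) ->
  exists r, [/\ chain r, r 0%N = u & forall i, r (n + i)%N = q i].
Proof.
move=> hq; elim: n u => [|n IH] u /=; first by move=> ->; exists q.
move=> [t ut /IH [r [hr r0 rq]]].
exists (fun i => if i is j.+1 then r j else u); split => //.
by move=> [|i] //=; rewrite r0.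
Qed.

Lemma chain_splice p q e n : chain p -> chain q -> reach n (p e) (q 0%N) ->
  exists r, [/\ chain r, forall i, (i <= e)%N -> r i = p i &
    forall i, r (e + n + i)%N = q i].
Proof.
move=> hp hq /(chain_prepend hq) [r [hr r0 rq]].
exists (fun i => if (i <= e)%N then p i else r (i - e)%N); split.
- move=> i; have [ie|ie] := leqP i.+1 e; first by rewrite ifT //; lia.
  have [->|ei] := eqVneq i e; first by rewrite leqnn -r0 subSnn; exact: hr.
  by rewrite ifF ?subSn; [exact: hr|lia|lia].
- by move=> i ->.
(* The two descriptions overlap only for [n] and [i] both 0, where the connecting path is
   trivial. *)
- move=> i; have [h|h] := leqP (e + n + i)%N e.
    have [n0 i0] : n = 0%N /\ i = 0%N by lia.
    by move: r0 (rq 0%N); rewrite n0 i0 !addn0 => ->.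
  by rewrite -rq; congr r; lia.
Qed.

Lemma alternating_chain u v : F (u, v) -> chain (fun i => if odd i then v else u).
Proof. by move=> uv i /=; case: (odd i) => //=; exact: lines_rel_sym. Qed.

(** * Connecting values by factors 2 and 3 *)

Hypothesis Om2 : Om 2.
Hypothesis Om3 : Om 3.

Lemma lines_rel_half u : 0 <= u <= 1 -> F (u, u / 2).
Proof.
move=> u01; apply/lines_relP; split => //; first by lra.
by exists 2^-1; [exact: Om_inv|rewrite mulrC].
Qed.

Lemma chain_extend p e n v : chain p -> 0 <= v <= 1 -> reach n (p e) v ->
  exists r, [/\ chain r, forall i, (i <= e)%N -> r i = p i & r (e + n)%N = v].
Proof.
(* Having reached [v], the chain oscillates between [v] and [v / 2]. *)
move=> hp v01 pv; have hq := alternating_chain (lines_rel_half v01).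
have [r [hr rp rq]] := @chain_splice p _ e n hp hq pv.
by exists r; split => //; rewrite -[(e + n)%N]addn0 rq.
Qed.

(* All the divisions come first, so the path never exceeds its ends. *)
Lemma reach_pow23 (a b c d : nat) u v : 0 <= u <= 1 -> 0 <= v <= 1 ->
  u * 2 ^+ c * 3 ^+ d = v * 2 ^+ a * 3 ^+ b -> reach (a + b + (c + d)) u v.
Proof.
move=> u01 v01 uv.
have pos2 k : (0 : R) < 2 ^+ k by rewrite exprn_gt0.
have pos3 k : (0 : R) < 3 ^+ k by rewrite exprn_gt0.
have ge2 k : (1 : R) <= 2 ^+ k by rewrite exprn_ege1 // ler1n.
have ge3 k : (1 : R) <= 3 ^+ k by rewrite exprn_ege1 // ler1n.
have inv1 (x : R) : 1 <= x -> 0 <= x^-1 <= 1.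
  by move=> x1; rewrite invr_ge0 invf_le1 //; lra.
have i2 := inv1 _ (ge2 a); have i3 := inv1 _ (ge3 b).
pose t := u / 2 ^+ a / 3 ^+ b.
have u1 : 0 <= u / 2 ^+ a <= 1 by nra.
have t0 : 0 <= t <= 1 by rewrite /t; nra.
have tv : 2 ^+ c * (3 ^+ d * t) = v.
  apply: (@mulIf _ (2 ^+ a * 3 ^+ b)); first by rewrite mulf_neq0 // gt_eqF.
  rewrite (mulrA v) -uv /t; field.
  by rewrite !gt_eqF.
apply: (@reach_trans _ _ _ t).
  apply: reach_trans; first exact: (reach_down a Om2 (ler1n _ 2) u01).
  exact: (reach_down b Om3 (ler1n _ 3) u1).
rewrite addnC; apply: (@reach_trans _ _ _ (3 ^+ d * t)).
  apply: (reach_up Om3 (ler1n _ 3)); first lra.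
  have := ge2 c; have : 0 <= 3 ^+ d * t by apply: mulr_ge0; [exact: ltW|lra].
  by nra.
rewrite -tv; apply: (reach_up Om2 (ler1n _ 2)); last lra.
by apply: mulr_ge0; [exact: ltW|lra].
Qed.

(** The powers of one [g] in (1, 1 + e) from the group of 2 and 3 form a grid fine enough for the
    error [e]. Since v / u lies between eta and 1 / eta, boundedly many powers occur, so [L] is
    uniform. *)
Lemma reach_dense eta e : 0 < eta -> 0 < e < 1 -> exists L, forall u v,
  eta <= u <= 1 -> eta <= v <= 1 ->
  exists n t, [/\ (n <= L)%N, (1 - e) * v <= t <= v & reach n u t].
Proof.
move=> eta0 /andP[e0 e1].
have [g [a [b [c [d gE]]]] /andP[g1 ge]] := pow23_dense e0.
have g0 : 0 < g by lra.
have gX k : 0 < g ^+ k by rewrite exprn_gt0.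
have [K hK] := exists_expn_gt eta^-1 g1.
have gXE k : g ^+ k * 2 ^+ (a * k) * 3 ^+ (b * k) = 2 ^+ (c * k) * 3 ^+ (d * k).
  by rewrite !exprM -!exprMn gE.
have ratio u v : eta <= u <= 1 -> eta <= v <= 1 -> v / u <= eta^-1.
  move=> u1 v1; rewrite ler_pdivrMr; last by lra.
  rewrite mulrC ler_pdivlMr //; nra.
have lek k h : g ^+ k <= h -> h <= eta^-1 -> (k < K)%N.
  move=> kh hh; rewrite -(ltr_eXn2l g1); lra.
exists (K * (a + b + (c + d)))%N => u v u1 v1.
have u0 : 0 < u by lra. have v0 : 0 < v by lra.
have near_v t : t <= v -> v <= t * g -> (1 - e) * v <= t <= v.
  by move=> tv vt; rewrite tv andbT; nra.
have [uv|/ltW vu] := leP u v.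
  have vu1 : 1 <= v / u by rewrite ler_pdivlMr // mul1r.
  have [k /andP[k1 k2]] := expn_floor g1 vu1.
  have kK := lek _ _ k1 (ratio _ _ u1 v1).
  move: k1 k2; rewrite ler_pdivlMr // ltr_pdivrMr // exprSr => k1 k2.
  have t0 := gX k.
  exists (a * k + b * k + (c * k + d * k))%N, (g ^+ k * u); split.
  - by rewrite -!mulnDl mulnC leq_mul2r ltnW ?orbT.
  - by apply: near_v => //; nra.
  - apply: reach_pow23; [lra|nra|].
    by rewrite -mulrA -gXE; ring.
(* Going down, the exponent is [k.+1], so that the value lands below [v] and not above it. *)
have uv1 : 1 <= u / v by rewrite ler_pdivlMr // mul1r.
have [k /andP[k1 k2]] := expn_floor g1 uv1.
have kK := lek _ _ k1 (ratio _ _ v1 u1).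
move: k1 k2; rewrite ler_pdivlMr // ltr_pdivrMr // => k1 k2.
have tE : u / g ^+ k.+1 * g ^+ k.+1 = u by rewrite divfK // gt_eqF.
have t0 : 0 < u / g ^+ k.+1 by rewrite divr_gt0.
set t := u / _ in tE t0 *.
have tv : t <= v by rewrite ler_pdivrMr // mulrC ltW.
exists (c * k.+1 + d * k.+1 + (a * k.+1 + b * k.+1))%N, t; split.
- by rewrite -!mulnDl mulnC (addnC (c + d)%N) leq_mul2r kK orbT.
- apply: near_v => //.
  have : v * g ^+ k <= t * g * g ^+ k by rewrite -mulrA -exprS tE mulrC.
  by rewrite ler_pM2r.
- apply: reach_pow23; [lra|lra|].
  by rewrite -[in LHS]tE -[RHS]mulrA -gXE; ring.
Qed.

(** * Neighbourhoods, shifts and the restriction map *)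

Lemma mah_mdist_window (x y : mahavier F) N e : 2 ^- N <= e ->
  (forall i : int, (`|i| <= N)%N -> `|x i - y i| <= e) -> mdist x y <= e.
Proof. exact: (mdist_le_window (0 : int) mah_unit). Qed.

Lemma mah_nbhs_window (x : mahavier F) (U : set (mahavier F)) : nbhs x U ->
  exists N e, [/\ 0 < e, e < 1 & forall z : mahavier F,
    (forall i : int, (`|i| <= N)%N -> `|x i - z i| <= e) -> U z].
Proof.
move=> /nbhs_ballP [r /= r0]; rewrite ballEmdist => rU.
have r0' : 0 < r by [].
have [e [e0 er e1]] : exists e : R, [/\ 0 < e, e < r & e < 1].
  by exists (Num.min r 1 / 2); rewrite /Num.min; case: ifP; split; lra.
have [N Ne] := exists_expn_lt e0.
exists N, e; split => // z xz; apply: rU => /=.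
exact: le_lt_trans (mah_mdist_window (ltW Ne) xz) er.
Qed.

Lemma mah_gt0 (x : mahavier F) i j : 0 < x i -> 0 < x j.
Proof.
move=> xi; pose N := (`|i| + `|j|)%N.
have := @chain_gt0 _ `|(i + N%:Z)%R|%N `|(j + N%:Z)%R|%N (mah_chain x N).
have -> : `|(i + N%:Z)%R|%N%:Z - N%:Z = i by rewrite /N; lia.
have -> : `|(j + N%:Z)%R|%N%:Z - N%:Z = j by rewrite /N; lia.
exact.
Qed.

Lemma alternating_half : chain (fun i => if odd i then 2^-1 else 1).
Proof.
apply: alternating_chain; have := @lines_rel_half 1; rewrite div1r; apply; lra.
Qed.

(** Positivity at one index gives positivity at all, so only the zero sequence has to be replaced,
    by a small multiple of an alternating orbit. *)
Lemma mah_gt0_dense (U : set (mahavier F)) : open U -> U !=set0 ->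
  exists x, U x /\ forall i, 0 < x i.
Proof.
move=> oU [x Ux]; have [x0|x0] := ltP 0 (x 0).
  by exists x; split => // i; exact: mah_gt0 x0.
have xz i : x i = 0.
  apply/eqP; rewrite eq_le; have /andP[-> _] := mah_unit x i; rewrite andbT.
  by rewrite leNgt; apply/negP => /(@mah_gt0 x i 0); rewrite ltNge x0.
have [N [e [e0 e1 eU]]] := mah_nbhs_window (open_nbhs_nbhs (conj oU Ux)).
exists (mah_scale e (mah_of_chain alternating_half 0)).
have ce : clamp e = e by rewrite clamp_id //; lra.
split.
  apply: eU => i _; rewrite /= ce xz sub0r normrN.
  by case: ifP => _; rewrite ger0_norm; lra.
by move=> i; rewrite /= ce; case: ifP => _; lra.
Qed.

Lemma iter_mah_shift n (x : mahavier F) i : iter n (mah_shift F) x i = x (i + n%:Z).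
Proof.
elim: n i => [|n IH] i /=; first by rewrite addr0.
by rewrite IH; congr (x _); lia.
Qed.

Lemma iter_mplus_shift n (x : mahavier_plus F) i :
  iter n (mplus_shift F) x i = x (i + n)%N.
Proof.
elim: n i => [|n IH] i /=; first by rewrite addn0.
by rewrite IH addSnnS.
Qed.

Lemma restrict_shift x : restrict (mah_shift F x) = mplus_shift F (restrict x).
Proof. by apply: mplus_inj; apply/funext => i /=; congr (x _); lia. Qed.

Lemma restrict_surjective y : exists x, restrict x = y.
Proof.
exists (mah_of_chain (mplus_chain y) 0); apply: mplus_inj; apply/funext => i /=.
by congr (y _); lia.
Qed.

Lemma mah_dist0 (x y : mahavier F) : `|x 0 - y 0| <= mdist x y.
Proof.
have := co_dist (0 : int) mah_unit (fun _ _ => erefl) x y 0.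
by rewrite expr0 mul1r.
Qed.

Lemma mplus_dist0 (x y : mahavier_plus F) : `|x 0%N - y 0%N| <= 2 * mdist x y.
Proof. exact: (co_dist 0%N mplus_unit (fun _ _ => erefl) x y 0%N). Qed.

(** Differences at index [i] are divided by 2^(i+1) in the one-sided metric and by 2^i in the
    two-sided one. *)
Lemma restrict_dist (x y : mahavier F) : mdist (restrict x) (restrict y) <= mdist x y.
Proof.
apply: (wsup_lub 0%N (mplus_itv _) (mplus_itv _)) => i /=.
have := co_dist (0 : int) mah_unit (fun _ _ => erefl) x y i%:Z.
rewrite mulrC -ler_pdivrMr ?exprn_gt0 // => h; apply: le_trans h.
by rewrite exprS invfM mulrCA ler_piMl // invf_le1 // ler1n.
Qed.

(** * Rescaling and the Lelek fan structure *)

Lemma rescale u t e : 0 < u -> 0 < e < 1 -> (1 - e) * u <= t <= u ->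
  exists c, [/\ clamp c = c, 1 - e <= c <= 1 & c * u = t].
Proof.
move=> u0 e01 tu.
have c1 : 1 - e <= t / u <= 1 by rewrite ler_pdivrMr // ler_pdivlMr // mul1r.
exists (t / u); split => //; first by rewrite clamp_id //; lra.
by rewrite divfK // gt_eqF.
Qed.

Lemma rescale_close c y e : 1 - e <= c <= 1 -> 0 <= y <= 1 -> `|y - c * y| <= e.
Proof.
move=> c1 y1; have -> : y - c * y = (1 - c) * y by ring.
by rewrite ger0_norm; nra.
Qed.

(** The full coordinate is found at a natural index, so that the property passes to the one-sided
    product under [restrict]. *)
Lemma mah_full_dense :
  dense [set x : mahavier F | exists j : nat, x j%:Z = 1].
Proof.
move=> U U0 oU; have [x [Ux x0]] := mah_gt0_dense oU U0.
have [N [e [e0 e1 eU]]] := mah_nbhs_window (open_nbhs_nbhs (conj oU Ux)).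
have e01 : 0 < e < 1 by lra.
(* From 1 one reaches a value [t] at or slightly below coordinate [N] of [x]; after rescaling [x] to
   take the value [t] there, the path is run backwards up to 1. *)
have [L /(_ 1 (x N%:Z)) [||n [t [_ tx rt]]]] := reach_dense (x0 N%:Z) e01.
- by have := mah_unit x N%:Z; lra.
- by have := mah_unit x N%:Z; lra.
have [c [cE c1 ct]] := rescale (x0 N%:Z) e01 tx.
have hp := chain_scale c (mah_chain x N).
have pe : clamp c * x ((2 * N)%N%:Z - N%:Z) = t.
  by rewrite cE double_subz.
have rt' := reach_sym rt; rewrite -pe in rt'.
have i01 : (0 : R) <= (1 : R) <= 1 by rewrite ler01 lexx.
have [r [hr rp r1]] := @chain_extend _ (2 * N)%N n 1 hp i01 rt'.
exists (mah_of_chain hr N); split; last first.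
  by exists (N + n)%N; rewrite /= double_add.
apply: eU => i iN; rewrite /= rp ?window_abs_le //.
rewrite cE window_absK //.
exact: rescale_close c1 (mah_unit x i).
Qed.

Lemma slopes_13 : [/\ F (1, 2^-1), F (2^-1, 1) & F (1, 3^-1)].
Proof.
have h : F (1, 2^-1).
  by have := @lines_rel_half 1; rewrite div1r; apply; lra.
split => //; first exact: lines_rel_sym.
apply/lines_relP; split; [lra|lra|].
by exists 3^-1; [exact: Om_inv|rewrite mulr1].
Qed.

Lemma mah_Lelek : Lelek_fan (mahavier F).
Proof.
have [h12 h21 h13] := slopes_13.
have c12 := alternating_chain h12; have c21 := alternating_chain h21.
have c13 := alternating_chain h13.
apply: (Lelek_fan_coordinates (j0 := 0 : int) (w := absz) (co := @mah_seq R F)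
  (scale := mah_scale) (D := fun i => slope_products `|i|%N)
  mah_unit (fun _ _ => erefl) int_window_finite
  (fun i => slope_products_finite `|i|%N) mah_ratio (fun _ _ _ => erefl) mah_complete
  (o := mah_scale 0 (mah_of_chain c12 0)) _
  (a := mah_of_chain c12 0) (b := mah_of_chain c21 0) (c := mah_of_chain c13 0)).
- by move=> j; rewrite /= clamp_id ?mul0r //; lra.
- by move=> /(_ 1) /=; lra.
- by move=> /(_ 1) /=; lra.
- by move=> /(_ 1) /=; lra.
- move=> O O0 oO; have [x [Ox [j xj]]] := mah_full_dense O0 oO.
  by exists x; split => //; exists j%:Z.
Qed.

Lemma mplus_Lelek : Lelek_fan (mahavier_plus F).
Proof.
have [h12 h21 h13] := slopes_13.
have c12 := alternating_chain h12; have c21 := alternating_chain h21.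
have c13 := alternating_chain h13.
apply: (Lelek_fan_coordinates (j0 := 0%N) (w := S) (co := @mplus_seq R F)
  (scale := mplus_scale) (D := slope_products)
  mplus_unit (fun _ _ => erefl) nat_window_finite
  slope_products_finite (fun x j => chain_ratio j (mplus_chain x))
  (fun _ _ _ => erefl) mplus_complete
  (o := mplus_scale 0 (plus_of_chain c12)) _
  (a := plus_of_chain c12) (b := plus_of_chain c21) (c := plus_of_chain c13)).
- by move=> j; rewrite /= clamp_id ?mul0r //; lra.
- by move=> /(_ 1%N) /=; lra.
- by move=> /(_ 1%N) /=; lra.
- by move=> /(_ 1%N) /=; lra.
- exact: (factor_dense restrict_surjective restrict_dist _ mah_full_dense).
Qed.

(** * Continuity, invertibility and non-injectivity of the shifts *)

Lemma mah_shift_continuous : continuous (mah_shift F).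
Proof.
apply: (@lipschitz_continuous _ _ _ 2) => x y.
apply: (wsup_lub (0 : int) (mah_itv _) (mah_itv _)) => i /=.
rewrite ler_pdivrMr ?exprn_gt0 //.
apply: le_trans (co_dist (0 : int) mah_unit (fun _ _ => erefl) x y (i + 1)) _.
rewrite mulrAC ler_wpM2r ?mdist_ge0 // -exprS ler_weXn2l ?ler1n //; lia.
Qed.

Lemma mah_unshift_rel (x : mahavier F) i : F (x (i - 1), x (i + 1 - 1)).
Proof. by have := mah_rel x (i - 1); rewrite subrK addrK. Qed.

Definition mah_unshift (x : mahavier F) : mahavier F :=
  @Mahavier R F (fun i => x (i - 1)) (fun i => mah_itv x (i - 1)) (mah_unshift_rel x).

Lemma mah_shiftK : cancel (mah_shift F) mah_unshift.
Proof. by move=> x; apply: mah_inj; apply/funext => i /=; rewrite subrK. Qed.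

Lemma mah_unshiftK : cancel mah_unshift (mah_shift F).
Proof. by move=> x; apply: mah_inj; apply/funext => i /=; rewrite addrK. Qed.

Lemma mah_shift_homeomorphism : homeomorphism (mah_shift F).
Proof.
split; first exact: mah_shift_continuous.
exists mah_unshift; split; [|exact: mah_shiftK|exact: mah_unshiftK].
apply: (@lipschitz_continuous _ _ _ 2) => x y.
apply: (wsup_lub (0 : int) (mah_itv _) (mah_itv _)) => i /=.
rewrite ler_pdivrMr ?exprn_gt0 //.
apply: le_trans (co_dist (0 : int) mah_unit (fun _ _ => erefl) x y (i - 1)) _.
rewrite mulrAC ler_wpM2r ?mdist_ge0 // -exprS ler_weXn2l ?ler1n //; lia.
Qed.

Lemma mplus_shift_continuous : continuous (mplus_shift F).
Proof.
apply: (@lipschitz_continuous _ _ _ 2) => x y.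
apply: (wsup_lub 0%N (mplus_itv _) (mplus_itv _)) => i /=.
rewrite ler_pdivrMr ?exprn_gt0 //.
apply: le_trans (co_dist 0%N mplus_unit (fun _ _ => erefl) x y i.+1) _.
by rewrite (exprS _ i.+1) mulrAC.
Qed.

(** Two sequences starting with 1/2 and 1/8 both continue with 1/4, 1/8, 1/4, and so on. *)
Lemma mplus_shift_not_injective : ~ injective (mplus_shift F).
Proof.
have q : 0 <= (4^-1 : R) <= 1 by lra.
have hq := alternating_chain (lines_rel_half q).
have F1 : reach 1 2^-1 (4^-1 : R).
  exists 4^-1 => //; have := @lines_rel_half 2^-1.
  have -> : 2^-1 / 2 = 4^-1 :> R by lra.
  by apply; lra.
have F2 : reach 1 (4^-1 / 2 : R) 4^-1.
  by exists 4^-1 => //; apply/lines_rel_sym/lines_rel_half.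
have [r [hr r0 rq]] := chain_prepend hq F1.
have [s [hs s0 sq]] := chain_prepend hq F2.
have same : mplus_shift F (plus_of_chain hr) = mplus_shift F (plus_of_chain hs).
  by apply: mplus_inj; apply/funext => i /=; rewrite -add1n rq sq.
move=> /(_ _ _ same) /(congr1 (fun x : mahavier_plus F => x 0%N)) /=.
by rewrite r0 s0; lra.
Qed.

(** * Transitivity, periodic points and sensitivity *)

Lemma mah_transitive : transitive_map (mah_shift F).
Proof.
move=> U V oU oV U0 V0.
have [x [Ux x0]] := mah_gt0_dense oU U0; have [y [Vy y0]] := mah_gt0_dense oV V0.
have [N1 [e1 [e10 e11 eU]]] := mah_nbhs_window (open_nbhs_nbhs (conj oU Ux)).
have [N2 [e [e0 e1' eV]]] := mah_nbhs_window (open_nbhs_nbhs (conj oV Vy)).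
pose N := maxn N1 N2.
have e01 : 0 < e < 1 by lra.
have eta0 : 0 < Num.min (x N%:Z) (y (- N%:Z)) by rewrite lt_min x0 y0.
have [L /(_ (x N%:Z) (y (- N%:Z))) [||n [t [_ ty rt]]]] := reach_dense eta0 e01.
- by rewrite ge_min lexx /=; have /andP[] := mah_unit x N%:Z.
- by rewrite ge_min lexx orbT /=; have /andP[] := mah_unit y (- N%:Z).
(* Scaling [y] by [c] makes its window begin with the value [t] reached from the end of the window
   of [x]. *)
have [c [cE c1 ct]] := rescale (y0 (- N%:Z)) e01 ty.
have hq := chain_scale c (mah_chain y N).
have pq : reach n (x ((2 * N)%N%:Z - N%:Z)) (clamp c * y (0%N%:Z - N%:Z)).
  by rewrite cE sub0r ct double_subz.
have [r [hr rp rq]] := @chain_splice _ _ (2 * N)%N n (mah_chain x N) hq pq.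
exists (2 * N + n)%N, (iter (2 * N + n) (mah_shift F) (mah_of_chain hr N)); split.
  exists (mah_of_chain hr N) => //; apply: eU => i iN /=.
  have iN' : (`|i| <= N)%N by rewrite (leq_trans iN) // leq_maxl.
  rewrite rp ?window_abs_le //.
  rewrite window_absK //.
  by rewrite subrr normr0 ltW.
apply: eV => i iN; rewrite iter_mah_shift /=.
have iN' : (`|i| <= N)%N by rewrite (leq_trans iN) // leq_maxr.
rewrite window_absD // rq cE window_absK //.
exact: rescale_close c1 (mah_unit y i).
Qed.

Lemma wave_rel p (hp : chain p) M N (i : int) : (0 < M)%N ->
  F (p (wave M (i + N%:Z)), p (wave M (i + 1 + N%:Z))).
Proof.
rewrite addrAC => /(wave_step (i + N%:Z)) [->|->]; first exact: hp.
exact/lines_rel_sym/hp.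
Qed.

(* Running back and forth along a long piece of an orbit. *)
Lemma mah_periodic_dense : dense [set x | periodic_point (mah_shift F) x].
Proof.
move=> U [x Ux] oU.
have [N [e [e0 e1 eU]]] := mah_nbhs_window (open_nbhs_nbhs (conj oU Ux)).
(* The shifted window 0, ..., 2 N lies on the rising part of the wave, and the successor keeps [M]
   positive. *)
pose M := (2 * N).+1%N.
pose p (i : nat) := x (i%:Z - N%:Z).
have hp : chain p := mah_chain x N.
pose z := @Mahavier R F (fun i : int => p (wave M (i + N%:Z)))
  (fun i => iffRL (unit_itvP _) (chain_itv _ hp)) (fun i => wave_rel hp N i (ltn0Sn _)).
exists z; split.
  apply: eU => i iN /=; rewrite wave_id //; [|lia|lia].
  have -> : p `|(i + N%:Z)%R|%N = x i by congr (x _); lia.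
  by rewrite subrr normr0 ltW.
exists (2 * M)%N => //; apply: mah_inj; apply/funext => i.
rewrite iter_mah_shift /=; congr p.
by rewrite -[RHS]wave_period; congr wave; lia.
Qed.

(** Two points of [U] are above 1/2 and at most 1/16 at one common later time, so [x] cannot be
    within 1/8 of both. That time is a natural number, so the argument also serves the one-sided
    shift. *)
Lemma mah_sensitive_coord (x : mahavier F) U : nbhs x U ->
  exists2 y, U y & exists n : nat, 8^-1 < `|x n%:Z - y n%:Z|.
Proof.
move=> xU.
have [x' [Ux x0]] : exists x', U^° x' /\ forall i, 0 < x' i.
  by apply: mah_gt0_dense; [exact: open_interior|exists x].
have [N [e [e0 e1 eU]]] := mah_nbhs_window Ux.
pose u := x' N%:Z; have u0 : 0 < u := x0 _.
have u1 : 0 <= u <= 1 := mah_unit x' N%:Z.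
have pu : x' ((2 * N)%N%:Z - N%:Z) = u by rewrite double_subz.
have iu : 1 <= u^-1 by rewrite invf_ge1 //; lra.
have i12 : (1 : R) < 2 by rewrite ltr1n.
have [k /andP[]] := expn_floor i12 iu.
rewrite -[u^-1]mul1r ler_pdivlMr // ltr_pdivrMr // exprS => k1 k2.
have k0 : (0 : R) < 2 ^+ k by rewrite exprn_gt0.
(* Both paths have length k + 4: one halves twice and doubles k + 2 times, the other only halves. *)
have up : reach (2 + (k + 2)) (x' ((2 * N)%N%:Z - N%:Z)) (2 ^+ k * u).
  rewrite pu; apply: reach_trans (reach_down 2 Om2 (ltW i12) u1) _.
  have -> : 2 ^+ k * u = 2 ^+ (k + 2) * (u / 2 ^+ 2) by rewrite exprD; field.
  apply: (reach_up Om2 (ltW i12)); first by rewrite divr_ge0 // ltW.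
  by have -> : 2 ^+ (k + 2) * (u / 2 ^+ 2) = 2 ^+ k * u by rewrite exprD; field.
have down : reach (2 + (k + 2)) (x' ((2 * N)%N%:Z - N%:Z)) (u / 2 ^+ (2 + (k + 2))).
  by rewrite pu; exact: (reach_down _ Om2 (ltW i12) u1).
have dE : u / 2 ^+ (2 + (k + 2)) <= 16^-1.
  rewrite ler_pdivrMr ?exprn_gt0 // !exprD.
  have : (1 : R) <= 2 ^+ k by rewrite exprn_ege1 // ltW.
  lra.
have d0 : 0 <= u / 2 ^+ (2 + (k + 2)) by rewrite divr_ge0 // ?exprn_ge0 // ltW.
have up1 : 0 <= 2 ^+ k * u <= 1 by nra.
have dn1 : 0 <= u / 2 ^+ (2 + (k + 2)) <= 1 by lra.
have [r [hr rp re]] := chain_extend (mah_chain x' N) up1 up.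
have [s [hs sp se]] := chain_extend (mah_chain x' N) dn1 down.
have inU q (hq : chain q) : (forall i, (i <= 2 * N)%N -> q i = x' (i%:Z - N%:Z)) ->
    U (mah_of_chain hq N).
  move=> qx; apply: eU => i iN /=; rewrite qx ?window_abs_le //.
  rewrite window_absK //.
  by rewrite subrr normr0 ltW.
have [far|near_] := ltP 8^-1 `|x (N + (2 + (k + 2)))%N%:Z - 2 ^+ k * u|.
  exists (mah_of_chain hr N); first exact: inU.
  exists (N + (2 + (k + 2)))%N; rewrite /=.
  by rewrite double_add re.
exists (mah_of_chain hs N); first exact: inU.
exists (N + (2 + (k + 2)))%N; rewrite /=.
rewrite double_add se ltNge; apply/negP; move: near_; rewrite !ler_norml.
lra.
Qed.

Lemma mah_sensitive : sensitive (mah_shift F).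
Proof.
exists 8^-1; first by rewrite invr_gt0.
move=> x U /mah_sensitive_coord [y Uy [n xy]]; exists y => //; exists n.
apply: lt_le_trans xy _.
have := mah_dist0 (iter n (mah_shift F) x) (iter n (mah_shift F) y).
by rewrite !iter_mah_shift !add0r.
Qed.

Lemma mplus_sensitive : sensitive (mplus_shift F).
Proof.
exists 16^-1; first by rewrite invr_gt0.
move=> x' U; have [x <-] := restrict_surjective x' => xU.
have : nbhs x (restrict @^-1` U) by exact: (factor_continuous restrict_dist).
move=> /mah_sensitive_coord [y Uy [n xy]]; exists (restrict y) => //; exists n.
have := mplus_dist0 (iter n (mplus_shift F) (restrict x))
  (iter n (mplus_shift F) (restrict y)).
by rewrite !iter_mplus_shift !add0n /=; lra.
Qed.

Lemma mah_Devaney : Devaney_chaotic (mah_shift F).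
Proof.
split; [exact: mah_transitive|exact: mah_periodic_dense|exact: mah_sensitive].
Qed.

Lemma mplus_Devaney : Devaney_chaotic (mplus_shift F).
Proof.
split; last exact: mplus_sensitive.
  exact: (factor_transitive restrict_shift restrict_surjective restrict_dist
    mah_transitive).
exact: (factor_periodic_dense restrict_shift restrict_surjective restrict_dist
  mah_periodic_dense).
Qed.

(** * Failure of shadowing *)

Section Shadowing.
(** The slopes 1/2 and 2 are isolated, so approximate knowledge of them is exact. *)
Hypothesis Om_half : forall a, Om a -> `|a - 2^-1| < 10^-1 -> a = 2^-1.
Hypothesis Om_two : forall a, Om a -> `|a - 2| < 2^-1 -> a = 2.

Lemma alternating_half_shift : chain (fun i => if odd i then 1 else 2^-1).
Proof. by move=> i; have := alternating_half i.+1; rewrite /= negbK; case: odd. Qed.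

Definition half_wave (b : bool) : mahavier F :=
  if b then mah_of_chain alternating_half_shift 0 else mah_of_chain alternating_half 0.

Lemma half_wave_shift b : mah_shift F (half_wave b) = half_wave (~~ b).
Proof.
have par (i : int) : odd `|(i + 1 + 0%N%:Z)%R|%N = ~~ odd `|(i + 0%N%:Z)%R|%N by lia.
by apply: mah_inj; apply/funext => i; case: b => /=; rewrite par; case: odd.
Qed.

Lemma half_wave0 b : half_wave b 0 = if b then 2^-1 else 1.
Proof. by case: b. Qed.

Lemma mah_scale_shift c (x : mahavier F) :
  mah_shift F (mah_scale c x) = mah_scale c (mah_shift F x).
Proof. exact: mah_inj. Qed.

Lemma mah_scale_dist c d (x : mahavier F) :
  mdist (mah_scale c x) (mah_scale d x) <= `|c - d|.
Proof.
by rewrite -[leRHS]mul1r; apply: (scale_lip (0 : int) mah_unit).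
Qed.

(* A slowly growing multiple of an orbit of period 2: an orbit near it
   alternates between the slopes 1/2 and 2 and so cannot grow. *)
Lemma drifting_pseudo_orbit delta : 0 < delta -> exists x : nat -> mahavier F,
  (forall k, mdist (mah_shift F (x k)) (x k.+1) < delta) /\
  forall y : mahavier_plus F,
    ~ forall k, mdist (iter k (mplus_shift F) y) (restrict (x k)) < 1000^-1.
Proof.
move=> delta0.
have [d [d0 ddelta d1]] : exists d : R, [/\ 0 < d, d < delta & d < 1000^-1].
  exists (Num.min delta 1000^-1 / 2).
  by rewrite /Num.min; case: ifP; split; lra.
(* The multiple climbs from 1/2 to 1 by steps of at most [d]. *)
pose s (k : nat) := Num.min 1 (2^-1 + d *+ k).
have s01 k : 2^-1 <= s k <= 1.
  have : 0 <= d *+ k by rewrite mulrn_wge0 // ltW.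
  by rewrite /s /Num.min; case: ifP; lra.
have s1 k : s k <= s k.+1 <= s k + d.
  by rewrite /s mulrSr /Num.min; do ! case: ifP; lra.
exists (fun k => mah_scale (s k) (half_wave (odd k))); split.
  move=> k; rewrite mah_scale_shift half_wave_shift.
  apply: le_lt_trans (mah_scale_dist _ _ _) _.
  by have s1k := s1 k; rewrite ler0_norm; lra.
move=> y near_y.
have yk k : `|y k - s k * (if odd k then 2^-1 else 1)| < 500^-1.
  have := near_y k; have := mplus_dist0 (iter k (mplus_shift F) y)
    (restrict (mah_scale (s k) (half_wave (odd k)))).
  rewrite iter_mplus_shift add0n /= half_wave0 clamp_id; last by have := s01 k; lra.
  lra.
have yF k : exists2 a, Om a & y k.+1 = a * y k.
  by have /lines_relP [] := mplus_rel y k.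
have down k : odd k = false -> y k.+1 = 2^-1 * y k.
  move=> ok; have [a Oa ya] := yF k; rewrite ya; congr (_ * _); apply: Om_half => //.
  have := yk k; have := yk k.+1; rewrite /= ok /= mulr1 ya => h1 h2.
  have s0 := s01 k; have := s1 k => s2.
  move: h1 h2; rewrite !ltr_norml => h1 h2.
  rewrite !ltNge -negb_or; apply/negP => /orP[] ha.
    have : 0 <= (2^-1 - 10^-1 - a) * y k by apply: mulr_ge0; lra.
    lra.
  have : 0 <= (a - 2^-1 - 10^-1) * y k by apply: mulr_ge0; lra.
  lra.
have up k : odd k -> y k.+1 = 2 * y k.
  move=> ok; have [a Oa ya] := yF k; rewrite ya; congr (_ * _); apply: Om_two => //.
  have := yk k; have := yk k.+1; rewrite /= ok /= mulr1 ya => h1 h2.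
  have s0 := s01 k; have := s1 k => s2.
  move: h1 h2; rewrite !ltr_norml => h1 h2.
  rewrite !ltNge -negb_or; apply/negP => /orP[] ha.
    have : 0 <= (2 - 2^-1 - a) * y k by apply: mulr_ge0; lra.
    lra.
  have : 0 <= (a - 2 - 2^-1) * y k by apply: mulr_ge0; lra.
  lra.
(* The forced slopes cancel in pairs, while the tracked value at even times rises from 1/2 to 1. *)
have y2 m : y (2 * m)%N = y 0%N.
  elim: m => // m IH; rewrite mulnS addSn add1n up; last by rewrite /= oddM.
  by rewrite down ?oddM // IH mulVKf.
have [m hm] : exists m : nat, 2^-1 <= d *+ m.
  exists (Num.bound (2^-1 / d)); rewrite -[d *+ _]mulr_natl -ler_pdivrMr // ltW //.
  by apply: archi_boundP; rewrite divr_ge0 // ltW.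
have sm : s (2 * m)%N = 1.
  have : d *+ m <= d *+ (2 * m) by rewrite mul2n -addnn mulrnDr lerDl mulrn_wge0 // ltW.
  by rewrite /s /Num.min; case: ifP; lra.
have := yk (2 * m)%N; have := yk 0%N; rewrite oddM /= sm y2 /s mulr0n addr0.
rewrite /Num.min; case: ifP; first by lra.
by rewrite !ltr_norml; lra.
Qed.

Lemma mah_not_shadowing : ~ shadowing (mah_shift F).
Proof.
move=> sh; have e0 : (0 : R) < 1000^-1 by lra.
have [delta delta0 shd] := sh _ e0.
have [x [xd nx]] := drifting_pseudo_orbit delta0.
have [y yx] := shd x xd; apply: (nx (restrict y)) => k.
rewrite -(factor_iter restrict_shift).
exact: le_lt_trans (restrict_dist _ _) (yx k).
Qed.

Lemma mplus_not_shadowing : ~ shadowing (mplus_shift F).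
Proof.
move=> sh; have e0 : (0 : R) < 1000^-1 by lra.
have [delta delta0 shd] := sh _ e0.
have [x [xd nx]] := drifting_pseudo_orbit delta0.
have [|y yx] := shd (restrict \o x); last exact: (nx y).
by move=> k /=; rewrite -restrict_shift; exact: le_lt_trans (restrict_dist _ _) (xd k).
Qed.

End Shadowing.

(** * Specification and mixing in the presence of slope 1 *)

Section Specification.
Hypothesis Om1 : Om 1.
Hypothesis Om_le3 : forall a, Om a -> a <= 3.

Lemma lines_rel_refl u : 0 <= u <= 1 -> F (u, u).
Proof. by move=> u01; apply/lines_relP; split => //; exists 1; rewrite ?mul1r. Qed.

Lemma reach_wait n m u v : 0 <= u <= 1 -> (n <= m)%N -> reach n u v -> reach m u v.
Proof.
move=> u01 nm uv; rewrite -(subnK nm); apply: reach_trans uv.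
by elim: (m - n)%N => [|k IH] //=; exists u => //; exact: lines_rel_refl.
Qed.

(* Values below eta are negligible, so the chain may wait at its first and last
   values above eta. *)
Lemma chain_truncate p (a b : nat) eta : chain p -> (a <= b)%N -> 0 < eta <= 1 ->
  exists q, [/\ chain q, eta <= q a, eta <= q b &
    forall m, (a <= m <= b)%N -> `|p m - q m| <= 3 * eta].
Proof.
move=> hp ab eta01.
(* If the whole block stays below [eta], the constant chain [eta] replaces it. *)
have [[s0 s0P]|none] := pselect (exists m, (a <= m <= b)%N && (eta <= p m)); last first.
  exists (fun=> eta); split; [|exact: lexx|exact: lexx|].
    by move=> i; apply: lines_rel_refl; lra.
  move=> m mab; have : p m < eta.
    by rewrite ltNge; apply/negP => h; apply: none; exists m; rewrite mab.
  by have := chain_itv m hp; rewrite ler_norml; lra.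
have ex : exists m, (a <= m <= b)%N && (eta <= p m) by exists s0.
have [t /andP[/andP[ta tb] pt] tmin] := ex_minnP ex.
have ub m : (a <= m <= b)%N && (eta <= p m) -> (m <= b)%N by lia.
have [s /andP[/andP[sa sb] ps] smax] := ex_maxnP ex ub.
have ts : (t <= s)%N by apply: tmin; rewrite sa sb.
have small u v : F (u, v) -> u < eta -> v <= 3 * eta.
  move=> /lines_relP [u1 _ [c Oc ->]] ue; have := Om_le3 Oc; have := Om_gt0 Oc; nra.
(* The index is clipped to [t, s]. If anything is cut off at [t] or [s], the adjacent value is below
   [eta], so by [small] the value waited at is at most 3 eta. *)
exists (fun m => p (maxn t (minn m s))); split.
- move=> i; have [it|it] := ltnP i t.
    have -> : maxn t (minn i.+1 s) = maxn t (minn i s) by lia.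
    by apply: lines_rel_refl; exact: chain_itv.
  have [si|si] := boolP (s <= i)%N.
    have -> : maxn t (minn i.+1 s) = maxn t (minn i s) by lia.
    by apply: lines_rel_refl; exact: chain_itv.
  have -> : maxn t (minn i.+1 s) = (maxn t (minn i s)).+1 by lia.
  exact: hp.
- by have -> : maxn t (minn a s) = t by lia.
- by have -> : maxn t (minn b s) = s by lia.
- move=> m /andP[am mb]; have pm := chain_itv m hp.
  have [mt|tm] := ltnP m t.
    have -> : maxn t (minn m s) = t by lia.
    have pme : p m < eta.
      by rewrite ltNge; apply/negP => h; have := tmin m; rewrite am mb h => /(_ isT); lia.
    have pt1 : p t.-1 < eta.
      rewrite ltNge; apply/negP => h; have := tmin t.-1; rewrite h andbT.
      have -> : (a <= t.-1 <= b)%N by lia.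
      by move=> /(_ isT); lia.
    have := hp t.-1; rewrite prednK; last by lia.
    move=> /small /(_ pt1); have := chain_itv t hp; rewrite ler_norml; lra.
  have [sm|ms] := boolP (s < m)%N.
    have -> : maxn t (minn m s) = s by lia.
    have above k : (s < k)%N -> (k <= b)%N -> p k < eta.
      move=> sk kb; rewrite ltNge; apply/negP => h.
      have := smax k; rewrite kb h (leq_trans sa (ltnW sk)) => /(_ isT); lia.
    have pme := above m sm mb.
    have ps1 := above s.+1 (ltnSn s) (leq_trans sm mb).
    have := lines_rel_sym (hp s); move=> /small /(_ ps1).
    by have := chain_itv s hp; rewrite ler_norml; lra.
  have -> : maxn t (minn m s) = m by lia.
  rewrite subrr normr0; lra.
Qed.

Lemma blocks_le (L n : nat) (k l : nat -> nat) :
  (forall j, (1 <= j <= n)%N -> (k j <= l j)%N) ->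
  (forall j, (1 <= j < n)%N -> (l j + L <= k j.+1)%N) ->
  forall i, (1 <= i <= n)%N -> (l i <= l n)%N.
Proof.
move=> kl lk i i1.
have mono d : (i + d <= n)%N -> (l i <= l (i + d))%N.
  elim: d => [|d IHd] h; first by rewrite addn0.
  have h1 : (l (i + d) + L <= k (i + d).+1)%N by apply: lk; lia.
  have h2 : (k (i + d).+1 <= l (i + d).+1)%N by apply: kl; lia.
  by rewrite addnS; apply: leq_trans (IHd _) _; lia.
have -> : l n = l (i + (n - i))%N by congr l; lia.
by apply: mono; lia.
Qed.

(** Blocks are appended one at a time. Truncation at e / 6 costs e / 2 and rescaling another e / 2;
    the factor is at least 1/2, so the last value stays above e / 12 and the same [L] connects to
    the next block. *)
Lemma chains_glue e : 0 < e < 1 -> exists L, forall n (P : nat -> nat -> R)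
    (k l : nat -> nat), (forall j, chain (P j)) ->
  (forall j, (1 <= j <= n.+1)%N -> (k j <= l j)%N) ->
  (forall j, (1 <= j < n.+1)%N -> (l j + L <= k j.+1)%N) ->
  exists r, [/\ chain r, e / 12 <= r (l n.+1) &
    forall i m, (1 <= i <= n.+1)%N -> (k i <= m <= l i)%N -> `|P i m - r m| <= e].
Proof.
move=> e01; have e12 : 0 < e / 12 by lra.
have e2 : 0 < e / 2 < 1 by lra.
have e6 : 0 < e / 6 <= 1 by lra.
have [L LP] := reach_dense e12 e2.
exists L; elim=> [|n IH] P k l hP kl lk.
  have kl1 := kl 1%N isT.
  have [q [hq _ ql qP]] := chain_truncate (hP 1%N) kl1 e6.
  exists q; split => //; first by lra.
  move=> i m i1; have -> : i = 1%N by lia.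
  by move=> /qP; lra.
have [||r [hr rl rP]] := IH P k l hP.
- by move=> j j1; apply: kl; lia.
- by move=> j j1; apply: lk; lia.
have kln : (k n.+2 <= l n.+2)%N by apply: kl; lia.
have lkn : (l n.+1 + L <= k n.+2)%N by apply: lk; lia.
have [q [hq qk ql qP]] := chain_truncate (hP n.+2) kln e6.
set k' := k n.+2 in kln lkn qk qP *; set l' := l n.+2 in kln ql qP *.
set l0 := l n.+1 in rl lkn *.
have r1 : e / 12 <= r l0 <= 1 by have := chain_itv l0 hr; lra.
have q1 : e / 12 <= q k' <= 1 by have := chain_itv k' hq; lra.
have [n0 [t [n0L tq rt]]] := LP _ _ r1 q1.
have [|c [cE c1 ct]] := rescale _ e2 tq; first by lra.
have hq' : chain (fun i => clamp c * q (k' + i)%N).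
  by apply: (chain_scale c (p := fun i => q (k' + i)%N)) => i; rewrite addnS; exact: hq.
(* Waiting stretches the connecting path to the exact length of the gap. *)
have rq : reach (k' - l0) (r l0) (clamp c * q (k' + 0)%N).
  rewrite cE addn0 ct; apply: reach_wait rt; first exact: chain_itv.
  by rewrite (leq_trans n0L) // leq_subRL ?(leq_trans _ lkn) ?leq_addr.
have [f [hf fr fq]] := chain_splice hr hq' rq.
have fk m : (k' <= m)%N -> f m = c * q m.
  move=> km; have := fq (m - k')%N; rewrite cE.
  by rewrite !subnKC // (leq_trans _ lkn) ?leq_addr.
exists f; split => //.
  rewrite fk //; have := chain_itv l' hq; nra.
move=> i m i1 km; have [iE|ni] := eqVneq i n.+2.
  rewrite iE in km *.
  rewrite fk; last by case/andP: km.
  have := rescale_close c1 (chain_itv m hq); have := qP _ km => h1 h2.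
  have -> : P n.+2 m - c * q m = (P n.+2 m - q m) + (q m - c * q m) by ring.
  by apply: le_trans (ler_normD _ _) _; lra.
have in1 : (1 <= i <= n.+1)%N by move: i1 ni; clear; lia.
have il : (l i <= l0)%N.
  apply: (blocks_le _ _ in1) => [j j1|j j1]; [apply: kl|apply: lk];
    by move: j1; clear; lia.
rewrite fr; last by apply: leq_trans il; case/andP: km.
exact: rP.
Qed.

Lemma mah_specification : specification (mah_shift F).
Proof.
move=> e0 e00.
have [e [e1 ee0]] : exists e : R, 0 < e < 1 /\ e <= e0.
  by exists (Num.min e0 2^-1); rewrite /Num.min; case: ifP; split; lra.
have [M Me] : exists M, 2 ^- M < e by apply: exists_expn_lt; lra.
have [L LP] := chains_glue e1.
(* Closeness at time [j] concerns indices j - M to j + M. Shifting indices by [M], each block is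
   lengthened by 2 M on the right, which the gap has to absorb besides [L]. *)
exists (2 * M + L).+1 => // -[//|n] x k l _ kl lk.
have [|||r [hr _ rP]] := LP n (fun j m => x j (m%:Z - M%:Z)) k (fun j => l j + 2 * M)%N.
- by move=> j; exact: mah_chain.
- by move=> j j1; rewrite (leq_trans (kl j j1)) ?leq_addr.
- by move=> j j1; have := lk j j1; lia.
exists (mah_of_chain hr M) => i j i1 kjl.
apply: le_trans ee0; apply: (@mah_mdist_window _ _ M _ (ltW Me)) => m mM.
rewrite !iter_mah_shift /= window_absD // distrC.
have := rP i (j + `|(m + M%:Z)%R|)%N i1.
have -> : (j + `|(m + M%:Z)%R|)%N%:Z - M%:Z = m + j%:Z by lia.
by apply; have := window_abs_le mM; lia.
Qed.

Lemma mah_mixing : topologically_mixing (mah_shift F).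
Proof.
apply: specification_mixing mah_specification => y.
by exists (mah_unshift y); exact: mah_unshiftK.
Qed.

Lemma mplus_specification : specification (mplus_shift F).
Proof.
exact: (factor_specification restrict_shift restrict_surjective restrict_dist
  mah_specification).
Qed.

Lemma mplus_mixing : topologically_mixing (mplus_shift F).
Proof.
apply: specification_mixing mplus_specification => y.
have [x <-] := restrict_surjective y.
by exists (restrict (mah_unshift x)); rewrite -restrict_shift mah_unshiftK.
Qed.

End Specification.

End Lines.

(** * The two concrete slope sets *)

Lemma Omega4_finite (R : realType) : finite_set (Omega4 R).
Proof. by rewrite /Omega4 !finite_setU; do !split. Qed.

Lemma Omega5_finite (R : realType) : finite_set (Omega5 R).
Proof. by rewrite /Omega5 !finite_setU; do !split. Qed.

Lemma Omega4_sub5 (R : realType) : Omega4 R `<=` Omega5 R.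
Proof. by move=> a Oa; left. Qed.

Lemma Omega5_bounds (R : realType) (a : R) : Omega5 R a -> 0 < a <= 3.
Proof. by move=> [[[[]|]|]|] ->; lra. Qed.

Lemma Omega4_inv (R : realType) (a : R) : Omega4 R a -> Omega4 R a^-1.
Proof.
move=> [[[]|]|] ->; rewrite ?invrK.
- by right.
- by left; right.
- by left; left; right.
- by left; left; left.
Qed.

Lemma Omega5_inv (R : realType) (a : R) : Omega5 R a -> Omega5 R a^-1.
Proof. by move=> [/Omega4_inv|->]; [left|rewrite invr1; right]. Qed.

Lemma Omega5_half (R : realType) (a : R) :
  Omega5 R a -> `|a - 2^-1| < 10^-1 -> a = 2^-1.
Proof. by move=> [[[[]|]|]|] -> //; rewrite ltr_norml; lra. Qed.

Lemma Omega5_two (R : realType) (a : R) : Omega5 R a -> `|a - 2| < 2^-1 -> a = 2.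
Proof. by move=> [[[[]|]|]|] -> //; rewrite ltr_norml; lra. Qed.

Theorem mainTheorem9 (R : realType) :
  let F4 := lines_rel (Omega4 R) in
  let F5 := lines_rel (Omega5 R) in
  [/\ ~ shadowing (mah_shift F4), ~ shadowing (mplus_shift F4),
      ~ shadowing (mah_shift F5) & ~ shadowing (mplus_shift F5)] /\
  [/\
    [/\ Lelek_fan (mahavier F4), homeomorphism (mah_shift F4) &
        Devaney_chaotic (mah_shift F4)],
    [/\ Lelek_fan (mahavier_plus F4), continuous (mplus_shift F4),
        ~ injective (mplus_shift F4) & Devaney_chaotic (mplus_shift F4)],
    [/\ Lelek_fan (mahavier F5), homeomorphism (mah_shift F5),
        Devaney_chaotic (mah_shift F5), topologically_mixing (mah_shift F5) &
        specification (mah_shift F5)] &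
    [/\ Lelek_fan (mahavier_plus F5),
        continuous (mplus_shift F5) /\ ~ injective (mplus_shift F5),
        Devaney_chaotic (mplus_shift F5),
        topologically_mixing (mplus_shift F5) &
        specification (mplus_shift F5)]].
Proof.
move=> F4 F5.
have fin4 := Omega4_finite R; have fin5 := Omega5_finite R.
have inv4 := @Omega4_inv R; have inv5 := @Omega5_inv R.
have sub := @Omega4_sub5 R.
have pos5 a : Omega5 R a -> 0 < a by case/Omega5_bounds/andP.
have le3 a : Omega5 R a -> a <= 3 by case/Omega5_bounds/andP.
have pos4 a : Omega4 R a -> 0 < a by move/sub/pos5.
have two4 : Omega4 R 2 by right.
have three4 : Omega4 R 3 by left; left; right.
have two5 := sub _ two4; have three5 := sub _ three4.
have one5 : Omega5 R 1 by right.
have half5 := @Omega5_half R; have isol5 := @Omega5_two R.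
have half4 a : Omega4 R a -> `|a - 2^-1| < 10^-1 -> a = 2^-1 by move/sub/half5.
have isol4 a : Omega4 R a -> `|a - 2| < 2^-1 -> a = 2 by move/sub/isol5.
split.
  by split; [apply: mah_not_shadowing|apply: mplus_not_shadowing
            |apply: mah_not_shadowing|apply: mplus_not_shadowing].
split.
- by split; [apply: mah_Lelek|apply: mah_shift_homeomorphism|apply: mah_Devaney].
- split; [by apply: mplus_Lelek|exact: mplus_shift_continuous| |by apply: mplus_Devaney].
  by apply: mplus_shift_not_injective.
- by split; [apply: mah_Lelek|apply: mah_shift_homeomorphism|apply: mah_Devaney
            |apply: mah_mixing|apply: mah_specification].
- split; [by apply: mplus_Lelek| |by apply: mplus_Devaney|by apply: mplus_mixing
         |by apply: mplus_specification].
  by split; [exact: mplus_shift_continuous|apply: mplus_shift_not_injective].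
Qed.
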